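(* Under the standing assumptions described in the context, let $A(t,\lambda)$ solve $\dot A=AX^G(t,\lambda)$, $A(0)=I_3$, let $Z(t,\lambda)\in q(D)$ be the sufficiently $CS$ function with $A=e^{Z}$, and let $X(\lambda)=\frac{|\omega_\lambda|}{2\pi}Z\!\left(\frac{2\pi}{|\omega_\lambda|},\lambda\right)$ for $\lambda\ge0$ small. Let $k\ge0$ be the integer with $\frac{2\pi|X_0|}{|\omega_{bif}|}=\alpha_0+2k\pi$, $\alpha_0\in[0,2\pi)$. Define $X^f(\lambda)$ for $\lambda\ge0$ small as follows. (1) If $|X_0|\ne l\,\omega_{bif}$ for all $l\in\mathbb Z$, put $X^f(\lambda)=\frac{|X(\lambda)|+k|\omega_\lambda|}{|X(\lambda)|}X(\lambda)$. (2) If $|X_0|=l\,\omega_{bif}$ for some $l\in\mathbb Z$, $l\ne0$, put $X^f(0)=X_0$ and, for $\lambda>0$ small, $X^f(\lambda)=\frac{|X(\lambda)|+k|\omega_\lambda|}{|X(\lambda)|}X(\lambda)$ if $|X(\lambda)|\neq0$, and $X^f(\lambda)=X(\lambda)+k|\omega_\lambda|Q(\lambda)$ with some $Q(\lambda)\in so(3)$, $|Q(\lambda)|=1$, if $|X(\lambda)|=0$. Then $\overrightarrow{X^f(\lambda)}$ is a primary frequency vector of $\mathbf\Phi(t,u_\lambda,\lambda)$ for $\lambda>0$ small and $X^f(0)=X_0$. Moreover, in case (1) the branch $X^f(\lambda)$ is sufficiently $CS$ for $\lambda\ge0$ small, with $$X^f(\lambda)=\left[|X_0|+O(\sqrt\lambda)\right]X_0^1+O(\sqrt\lambda)X_1+O(\sqrt\lambda)X_2,$$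 and the branch $\mathbf\Phi(t,u_\lambda,\lambda)$ contains only modulated rotating waves for $\lambda > 0$ small; in case (2), $|X^f(\lambda)|$ is continuous for $\lambda\ge0$ small and $|X^f(\lambda)|=|X_0|+O(\lambda^{1/4})$.
   Context: Regularity conventions. ''Sufficiently smooth'' means of class $C^m$ with $m\ge1$ as large as required, the data being assumed $C^M$ with $M$ large enough. A function $Y(x,\lambda)$, $\lambda\in[0,\lambda_0)$, with values in a smooth manifold is called sufficiently $CS$ if $(x,\epsilon)\mapsto Y(x,\epsilon^2)$ is sufficiently smooth for $\epsilon\in[0,\sqrt{\lambda_0})$. The equation. Let $r>0$, $\mathbf S^2\subset\mathbb R^3$ the unit sphere, $N\ge1$, $D_{\rm diff}=\mathrm{diag}(d_1,\dots,d_N)$ with $d_i\ge0$, $\Delta_S$ the Laplace-Beltrami operator on $r\mathbf S^2$, $F:\mathbb R^N\times\mathbb R\to\mathbb R^N$ of class $C^{p+2}$, $3\le p\le\infty$, with $F(0,\lambda)=0$. Consider $\partial_t u=D_{\rm diff}\Delta_S u+F(u,\lambda)$ on $r\mathbf S^2$. Let $\mathbf Y=L^2(r\mathbf S^2,\mathbb R^N)$ if all $d_i>0$ and $\mathbf Y=H^2(r\mathbf S^2,\mathbb R^N)$ otherwise; let $\alpha\in(\frac12,1)$ and let $\mathbf Y^\alpha$ be the domain of $(I-D_{\rm diff}\Delta_S)^\alpha$. The equation defines a sufficiently smooth local semiflow $\mathbf\Phi(t,u,\lambda)$ on $\mathbf Y^\alpha$, equivariant under the action $(Au)(x)=u(A^{-1}x)$,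 $A\in SO(3)$. $so(3)$ is the space of real antisymmetric $3\times3$ matrices; $I_3,O_3$ are the identity and zero matrices; for $Y\in so(3)$, $\overrightarrow Y\in\mathbb R^3$ is the vector with $Yw=\overrightarrow Y\times w$ for all $w$ (so $\overrightarrow{[X,Y]}=\overrightarrow X\times\overrightarrow Y$) and $|Y|=\|\overrightarrow Y\|$. Standing assumptions. $u_0\in\mathbf Y^\alpha$ has trivial isotropy $\{I_3\}$ and is a relative equilibrium, not an equilibrium, at $\lambda=0$: $\mathbf\Phi(t,u_0,0)=e^{X_0t}u_0$, $X_0\in so(3)$, $X_0\ne O_3$. With $L=D_{\rm diff}\Delta_S+D_uF(u_0,0)-X_0$ ($X_0$ acting as infinitesimal generator), assume $\sigma(L)\cap\{\mathrm{Re}\,z\ge0\}$ is a spectral set with spectral projection $P_*$, $\dim R(P_* )=5$, and $|e^{Lt}|_{R(1-P_* )}|\le Ce^{-\beta_0t}$ for some $C,\beta_0>0$. Then (equivariant center manifold reduction), with $V_*$ the orthogonal complement of $T_{u_0}(SO(3)u_0)$ in $R(P_* )$, there are a center manifold $M^{cu}_{u_0}(\lambda)$ diffeomorphic to $SO(3)\times V_*$ via $(A,q)\mapsto A\Psi(q)$ ($\Psi$ a local chart) and sufficiently smooth $X_G:V_*\times\mathbb R\to so(3)$, $X_N:V_*\times\mathbb R\to V_*$ with $X_G(0,0)=X_0$, $X_N(0,0)=0$, such that solutions of $\dot A=AX_G(q,\lambda)$, $\dot q=X_N(q,\lambda)$ correspond to solutions on $M^{cu}_{u_0}(\lambda)$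 for $|\lambda|$ small. A supercritical Hopf bifurcation occurs in $\dot q=X_N(q,\lambda)$ at $q=0,\lambda=0$: $X_N(0,\lambda)=0$ for $|\lambda|$ small; $D_qX_N(0,\lambda)$ has eigenvalues $\alpha(\lambda)\pm i(\omega_{bif}+\beta(\lambda))$, $\alpha(0)=\beta(0)=0$, $\alpha'(0)>0$, $\omega_{bif}\neq 0$; and a stable periodic solution $q(t,\lambda)=\sqrt\lambda\,r(t,\lambda)=O(\sqrt\lambda)$, sufficiently $CS$, of period $\frac{2\pi}{|\omega_\lambda|}$, $\omega_\lambda=\omega_{bif}+O(\lambda)$, bifurcates for $\lambda>0$ small; $q(t,0)=0$. $X^G(t,\lambda)=X_G(q(t,\lambda),\lambda)$ for $\lambda>0$, and $X^G(t,0)=X_0$, for $t\in[0,\infty)$; it is sufficiently $CS$ and $\frac{2\pi}{|\omega_\lambda|}$-periodic in $t$. The branch of solutions is $\mathbf\Phi(t,u_\lambda,\lambda)=A(t,\lambda)\Psi(q(t,\lambda))$ with $u_\lambda=\Psi(q(0,\lambda))$; for $\lambda>0$ small it is a modulated rotating wave of relative period $T(\lambda)=\frac{2\pi}{|\omega_\lambda|}$ or a $T(\lambda)$-periodic solution. Basis. $X_0^1=\frac1{|X_0|}X_0$, and $X_1,X_2\in so(3)$ are chosen so that $\overrightarrow{X_0^1},\overrightarrow{X_1},\overrightarrow{X_2}$ is an orthonormal basis of $\mathbb R^3$ with $[X_0^1,X_1]=X_2$, $[X_1,X_2]=X_0^1$, $[X_2,X_0^1]=X_1$. Primary frequency vectors.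 $\overrightarrow X$ is a primary frequency vector of $\mathbf\Phi(t,u_\lambda,\lambda)$ if $\mathbf\Phi(T(\lambda),u_\lambda,\lambda)=e^{XT(\lambda)}u_\lambda$, where $T(\lambda)$ is the least $t>0$ with $\mathbf\Phi(t,u_\lambda,\lambda)\in SO(3)u_\lambda$ (in the periodic case any $\overrightarrow X$ with $|X|=\frac{2l\pi}{T(\lambda)}$, $l\in\mathbb Z$, is one); the solution is a modulated rotating wave if in addition $|X|T(\lambda)\ne2l\pi$ for all $l\in\mathbb Z$. The set $q(D)$. The north hemisphere of $\mathbf S^2$ is $\{(x,y,z)\in\mathbf S^2\mid z>0,\text{ or }z=0,\ x\in[-1,1),\ y\in[0,1]\}$, the south hemisphere is its complement. $D$ is the quotient of $\{Y\in so(3)\mid|Y|\le\pi\}$ obtained by identifying $Y$ with $-Y$ when $|Y|=\pi$; it is a model of $\mathbb{R}P^3$, and $[Y]\mapsto e^{Y}$ is a diffeomorphism $D\to SO(3)$. The map $q$ (not to be confused with the variable $q\in V_*$) is $q([Y])=Y$ if $Y=O_3$ or if $\frac1{|Y|}\overrightarrow Y$ and $\frac1{|X_0|}\overrightarrow{X_0}$ are in the same hemisphere, and $q([Y])=\left(1-\frac{2\pi}{|Y|}\right)Y$ otherwise; one has $e^{q([Y])}=e^{Y}$. Elements of norm $2\pi$ are identified with $O_3$ (so norms $0$ and $2\pi$ of elements of $q(D)$ are identified), and $q$ is regarded as a smooth map onto $q(D)$, so $q(D)$ carries the smooth structure transported from $D$.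
   Formalization: As q jumps, smoothness and expansion in case (1) for X_0 on the equator, and continuity and rate of |X^f| in case (2), are stated for X^f(λ) or the value from the same formula with (1-2π/|Z|)Z in place of Z; literally they can fail. Off the equator case (1) is for X^f itself. *)

(* Defs.v *)
From HB Require Import structures.
From mathcomp Require Import all_boot all_order all_algebra.
From mathcomp Require Import all_classical all_reals all_analysis.
From mathcomp Require Import complex.

Set Implicit Arguments.
Unset Strict Implicit.
Unset Printing Implicit Defensive.

Import Order.TTheory GRing.Theory Num.Theory.
Import numFieldNormedType.Exports.

Local Open Scope classical_set_scope.
Local Open Scope ring_scope.

Section Regularity.
Context {R : realType}.

(** [Ck k U f], for [U] open: a map of class C^{k+1} is a differentiable map
    whose tangent map [(x, v) |-> 'd f x v] is of class C^k.  For a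
    finite-dimensional source this is exactly the usual notion; for a general
    normed source it differs from the Frechet one by at most one order, which is
    immaterial for "sufficiently smooth". *)
Fixpoint Ck (k : nat) : forall V W : normedModType R, set V -> (V -> W) -> Prop :=
  match k with
  | 0 => fun V W U f => forall x, U x -> {for x, continuous f}
  | k'.+1 => fun V W U f =>
      (forall x, U x -> differentiable f x) /\
      @Ck k' (V * V)%type W [set p | U p.1] (fun p => 'd f (p.1) (p.2))
  end.

(** Class C^k on a set that need not be open (such as a half-open interval):
    the restriction of a C^k map defined near the set. *)
Definition Ck_on (k : nat) (V W : normedModType R) (S : set V) (f : V -> W) :=
  exists U : set V, exists g : V -> W,
    [/\ open U, S `<=` U, Ck k U g & forall x, S x -> f x = g x].

(** [Y(lambda)] and [Y(t, lambda)], [t >= 0], [0 <= lambda < l0], are CS of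
    class C^k if [Y(eps^2)] and [Y(t, eps^2)] are of class C^k for
    [0 <= eps < sqrt l0]. *)
Definition CS (k : nat) (W : normedModType R) (l0 : R) (Y : R -> W) :=
  Ck_on k [set e : R | 0 <= e < Num.sqrt l0] (fun e => Y (e ^+ 2)).

Definition CSt (k : nat) (W : normedModType R) (l0 : R) (Y : R -> R -> W) :=
  Ck_on k [set p : (R * R)%type | 0 <= p.1 /\ 0 <= p.2 < Num.sqrt l0]
    (fun p => Y p.1 (p.2 ^+ 2)).

Definition ode_on (W : normedModType R) (tau : R) (f : R -> W -> W) (x : R -> W) :=
  {within `[0, tau], continuous x} /\
  forall t : R, 0 < t < tau -> is_derive t (1 : R) x (f t (x t)).

Definition ode_halfline (W : normedModType R) (f : R -> W -> W) (x : R -> W) :=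
  {within `[0, +oo[, continuous x} /\
  forall t : R, 0 < t -> is_derive t (1 : R) x (f t (x t)).

End Regularity.

Section Rotations.
Context {R : realType}.

Definition SO3 (A : 'M[R]_3) : Prop := A *m A^T = 1%:M /\ \det A = 1.
Definition so3 (X : 'M[R]_3) : Prop := X^T = - X.
Definition bracket (X Y : 'M[R]_3) : 'M[R]_3 := X *m Y - Y *m X.

Definition expm (X : 'M[R]_3) : 'M[R]_3 :=
  lim ((fun n : nat => \sum_(k < n) (k`!%:R)^-1 *: X ^+ k) @ \oo).

Definition dot3 (u v : 'cV[R]_3) : R := \sum_i u i 0 * v i 0.
Definition enorm (v : 'cV[R]_3) : R := Num.sqrt (dot3 v v).

(* The indices [i + 1] and [i + 2] are taken modulo 3. *)
Definition cross (u v : 'cV[R]_3) : 'cV[R]_3 :=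
  \col_i (u (i + 1) 0 * v (i + 2) 0 - u (i + 2) 0 * v (i + 1) 0).

(** For [Y] antisymmetric, [Y *m w = cross (vec Y) w]; [hat] is the inverse. *)
Definition vec (Y : 'M[R]_3) : 'cV[R]_3 := \col_i Y (i + 2) (i + 1).
Definition hat (u : 'cV[R]_3) : 'M[R]_3 :=
  \matrix_(i, j) cross u (delta_mx j 0) i 0.

Definition snorm (Y : 'M[R]_3) : R := enorm (vec Y).

Definition north (v : 'cV[R]_3) : Prop :=
  0 < v 2 0 \/ [/\ v 2 0 = 0, -1 <= v 0 0 < 1 & 0 <= v 1 0 <= 1].

Definition same_hemisphere (X Y : 'M[R]_3) : Prop :=
  north ((snorm X)^-1 *: vec X) <-> north ((snorm Y)^-1 *: vec Y).

Definition qmap (X0 Y : 'M[R]_3) : 'M[R]_3 :=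
  if `[< Y = 0 \/ same_hemisphere Y X0 >] then Y
  else (1 - 2 * pi / snorm Y) *: Y.

Definition qD (X0 : 'M[R]_3) : set 'M[R]_3 :=
  qmap X0 @` [set Y | so3 Y /\ snorm Y <= pi].

(** [q(D)] carries the smooth structure transported from [D], and
    [[Y] |-> expm Y] is a diffeomorphism from [D] onto SO(3); since
    [expm (q [Y]) = expm Y], a [q(D)]-valued map is CS if and only if its
    exponential is a CS map into SO(3), a submanifold of the matrices. *)
Definition CSt_qD (k : nat) (l0 : R) (Z : R -> R -> 'M[R]_3) :=
  CSt k l0 (fun t l => expm (Z t l)).

(** As the map [q] jumps between [Z] and [(1 - 2 pi / |Z|) Z] when the direction
    of [Z] crosses the boundary of the hemisphere, and as norms [0] and [2 pi]
    are identified, the smooth structure of [q(D)] is compared with the linear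
    one of so(3) by choosing, for each point, one of the two matrices
    [Z], [(1 - 2 pi / |Z|) Z], which have the same exponential.
    With [X = |omega| / (2 pi) Z] and [Xf = (|X| + k |omega|) / |X| X], the same
    choice for [Z] turns [Xf] into [(1 - (2 k + 1) |omega| / |Xf|) Xf]. *)
Definition glued (k : nat) (omega : R) (X X' : 'M[R]_3) : Prop :=
  X' = X \/
  (X <> 0 /\ X' = (1 - (2 * k + 1)%N%:R * `|omega| / snorm X) *: X).

End Rotations.

Section Sphere.
Context {R : realType} (r : R).

Definition sph (th ph : R) : 'cV[R]_3 :=
  \col_(i < 3) nth 0 [:: r * (sin th * cos ph); r * (sin th * sin ph); r * cos th] i.

Definition rect : set (R * R) := `[0, pi]%classic `*` `[0, 2 * pi]%classic.

Definition leb2 := (@lebesgue_measure R \x @lebesgue_measure R)%E.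

Definition sphere_ae (P : 'cV[R]_3 -> Prop) : Prop :=
  {ae leb2, forall p, rect p -> P (sph p.1 p.2)}.

Definition sphere_int (f : 'cV[R]_3 -> R) : R :=
  (\int[leb2]_(p in rect) (f (sph p.1 p.2) * (r ^+ 2 * sin p.1))).

Definition sqint (f : 'cV[R]_3 -> R) : Prop :=
  measurable_fun rect (fun p : R * R => f (sph p.1 p.2)) /\
  leb2.-integrable rect
    (fun p => ((f (sph p.1 p.2)) ^+ 2 * (r ^+ 2 * sin p.1))%:E).

Definition smooth (phi : 'cV[R]_3 -> R) : Prop := forall k, Ck k setT phi.

(** Laplace-Beltrami operator on the sphere of radius [r]: the Euclidean
    Laplacian of the extension that is constant along rays. *)
Definition LapS (phi : 'cV[R]_3 -> R) (x : 'cV[R]_3) : R :=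
  let ext := fun y : 'cV[R]_3 => phi ((r / enorm y) *: y) in
  \sum_(i < 3) 'D_(delta_mx i 0 : 'cV[R]_3) ('D_(delta_mx i 0 : 'cV[R]_3) ext) x.

Definition weak_LapS (f g : 'cV[R]_3 -> R) : Prop :=
  forall phi, smooth phi ->
    sphere_int (fun x => g x * phi x) = sphere_int (fun x => f x * LapS phi x).

Definition LapS_eigenfunction (nu : R) (phi : 'cV[R]_3 -> R) : Prop :=
  smooth phi /\ forall x, enorm x = r -> LapS phi x = - nu * phi x.

Definition rotation_act (E : completeNormedModType R) (N : nat)
    (rep : E -> 'cV[R]_3 -> 'cV[R]_N) (A : 'M[R]_3) (u : E) : E :=
  xget 0 [set v | sphere_ae (fun x => rep v x = rep u (invmx A *m x))].

End Sphere.

Section Equation.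
Context {R : realType} (r : R) (N : nat) (d : 'I_N -> R).
Context (F : 'cV[R]_N * R -> 'cV[R]_N) (al : R).

(** L^2 if all [d i > 0], and H^2 otherwise (with norm [|(I - Delta_S) u|_{L^2}]). *)
Definition in_Y (f : 'cV[R]_3 -> 'cV[R]_N) : Prop :=
  (forall i, sqint r (fun x => f x i 0)) /\
  ((forall i, 0 < d i) \/
   forall i, exists g, sqint r g /\ weak_LapS r (fun x => f x i 0) g).

Definition is_Y_norm (f : 'cV[R]_3 -> 'cV[R]_N) (a : R) : Prop :=
  ((forall i, 0 < d i) ->
   a ^+ 2 = \sum_i sphere_int r (fun x => (f x i 0) ^+ 2)) /\
  (~ (forall i, 0 < d i) ->
   forall g : 'I_N -> 'cV[R]_3 -> R,
   (forall i, sqint r (g i) /\ weak_LapS r (fun x => f x i 0) (g i)) ->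
   a ^+ 2 = \sum_i sphere_int r (fun x => (f x i 0 - g i x) ^+ 2)).

(** [Y], with [rep u] a representative of the class [u], is the Hilbert space
    of classes of functions modulo equality almost everywhere. *)
Definition is_model_of_Y (Y : completeNormedModType R)
    (rep : Y -> 'cV[R]_3 -> 'cV[R]_N) : Prop :=
  [/\ forall u, in_Y (rep u),
      forall (a : R) u v,
        sphere_ae r (fun x => rep (a *: u + v) x = a *: rep u x + rep v x),
      forall u, is_Y_norm (rep u) `|u|
    & forall f, in_Y f -> exists u, sphere_ae r (fun x => rep u x = f x)].

Context (Y : completeNormedModType R) (rep : Y -> 'cV[R]_3 -> 'cV[R]_N).

(* The inner product of [Y], by polarization. *)
Definition dotY (u v : Y) : R := (`|u + v| ^+ 2 - `|u - v| ^+ 2) / 4.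

Definition pairing (u : Y) (i : 'I_N) (phi : 'cV[R]_3 -> R) : R :=
  sphere_int r (fun x => rep u x i 0 * phi x).

(** [v = (I - D_diff Delta_S)^al u], by the spectral theorem. *)
Definition fracpow (u v : Y) : Prop :=
  forall i nu phi, LapS_eigenfunction r nu phi ->
    pairing v i phi = (1 + d i * nu) `^ al * pairing u i phi.

(** [Ya], embedded in [Y] by [j], is the domain of that operator with its graph
    norm (the operator is bounded below by 1). *)
Definition is_model_of_Yal (Ya : completeNormedModType R)
    (j : {linear Ya -> Y}) : Prop :=
  (forall u, (exists a, j a = u) <-> (exists v, fracpow u v)) /\
  (forall a v, fracpow (j a) v -> `|a| = `|v|).

Context (Ya : completeNormedModType R) (j : {linear Ya -> Y}).

(** Solutions of [du/dt = D_diff Delta_S u + F(u, l)] on [0, tau] in [Ya], tested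
    against smooth functions. *)
Definition pde_solution (l tau : R) (w : R -> Ya) : Prop :=
  {within `[0, tau], continuous w} /\
  forall (i : 'I_N) phi (t : R), smooth phi -> 0 < t < tau ->
    is_derive t (1 : R) (fun s : R => pairing (j (w s)) i phi)
      (d i * pairing (j (w t)) i (LapS r phi)
       + sphere_int r (fun x => F (rep (j (w t)) x, l) i 0 * phi x)).

Definition actY := rotation_act r rep.
Definition actYa := rotation_act r (fun a : Ya => rep (j a)).

(** [Phi t u l = None] if the solution starting at [u] does not exist up to
    time [t]. *)
Definition is_local_semiflow (M : nat) (Phi : R -> Ya -> R -> option Ya) : Prop :=
  [/\ forall t u l v, 0 <= t ->
        (Phi t u l = Some v <->
         exists w, [/\ pde_solution l t w, w 0 = u & w t = v]),
      forall t, 0 <= t ->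
        open [set p : (Ya * R)%type | Phi t p.1 p.2 <> None] /\
        Ck M [set p : (Ya * R)%type | Phi t p.1 p.2 <> None]
          (fun p => odflt 0 (Phi t p.1 p.2))
    & forall A t u l, SO3 A -> 0 <= t ->
        Phi t (actYa A u) l = omap (actYa A) (Phi t u l)].

Definition generator (xi : 'M[R]_3) (u w : Y) : Prop :=
  (fun h : R => h^-1 *: (actY (expm (h *: xi)) u - u)) @ 0^' --> w.

Definition is_diffusion (u w : Y) : Prop :=
  forall i phi, smooth phi ->
    pairing w i phi = d i * pairing u i (LapS r phi).

Definition is_DF (u0 : Ya) (u w : Y) : Prop :=
  sphere_ae r (fun x =>
    rep w x = 'D_(rep u x) (fun y => F (y, 0)) (rep (j u0) x)).

(** [Lop u w] : [u] is in the domain of [L] and [L u = w]; [L] is the closure of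
    the sum [D_diff Delta_S + D_u F(u0, 0) - X0] of the three operators. *)
Definition Lop (u0 : Ya) (X0 : 'M[R]_3) (u w : Y) : Prop :=
  closure [set p : (Y * Y)%type | exists a b c,
    [/\ is_diffusion p.1 a, is_DF u0 p.1 b, generator X0 p.1 c
      & p.2 = a + b - c]] (u, w).

(** Resolvent set of the part of [L] in the subspace [S], complexified:
    [(z - L)(u + i v) = f + i g] with [z = z.1 + i z.2]. *)
Definition resolvent_eq (L : Y -> Y -> Prop) (z : R * R) (u v f g : Y) : Prop :=
  exists Lu Lv, [/\ L u Lu, L v Lv,
    f = z.1 *: u - z.2 *: v - Lu & g = z.1 *: v + z.2 *: u - Lv].

Definition resolvent_in (S : set Y) (L : Y -> Y -> Prop) (z : R * R) : Prop :=
  (forall f g, S f -> S g ->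
     exists u v, [/\ S u, S v & resolvent_eq L z u v f g]) /\
  (exists C : R, forall u v f g, S u -> S v -> S f -> S g ->
     resolvent_eq L z u v f g -> `|u| + `|v| <= C * (`|f| + `|g|)).

Definition spectrum_in (S : set Y) (L : Y -> Y -> Prop) : set (R * R) :=
  [set z | ~ resolvent_in S L z].

Definition is_spectral_set (L : Y -> Y -> Prop) (s : set (R * R)) : Prop :=
  [/\ s `<=` spectrum_in setT L, bounded_set s, closed s
    & closed (spectrum_in setT L `\` s)].

(** The spectral projection of the spectral set [s]: the bounded projection that
    splits [L] into a bounded part with spectrum [s] and a part with the
    remaining spectrum. *)
Definition is_spectral_projection (L : Y -> Y -> Prop) (s : set (R * R))
    (P : {linear Y -> Y}) : Prop :=
  [/\ continuous P /\ (forall u, P (P u) = P u),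
      forall u w, L u w -> L (P u) (P w),
      exists C : R, forall u, exists w, L (P u) w /\ `|w| <= C * `|P u|,
      spectrum_in (range P) L = s
    & spectrum_in [set u | P u = 0] L = spectrum_in setT L `\` s].

(** [S] is the strongly continuous semigroup [e^{Lt}]. *)
Definition is_semigroup_of (L : Y -> Y -> Prop) (S : R -> Y -> Y) : Prop :=
  [/\ forall u, S 0 u = u,
      forall s t u, 0 <= s -> 0 <= t -> S (s + t) u = S s (S t u),
      forall t, 0 <= t -> linear (S t) /\ continuous (S t),
      forall u, {within `[0, +oo[, continuous (fun t => S t u)}
    & forall u w, L u w <-> (fun h : R => h^-1 *: (S h u - u)) @ 0^'+ --> w].

Definition right_half_spectrum (L : Y -> Y -> Prop) : set (R * R) :=
  [set z | spectrum_in setT L z /\ 0 <= z.1].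

Definition has_dim (n : nat) (S : set Y) : Prop :=
  exists e : {linear 'rV[R]_n -> Y}, injective e /\ range e = S.

Definition spectral_assumption (L : Y -> Y -> Prop) (P : {linear Y -> Y}) : Prop :=
  [/\ is_spectral_set L (right_half_spectrum L),
      is_spectral_projection L (right_half_spectrum L) P,
      has_dim 5 (range P)
    & exists S C b, [/\ is_semigroup_of L S, 0 < C, 0 < b &
        forall t u, 0 <= t -> P u = 0 -> `|S t u| <= C * expR (- b * t) * `|u|]].

Definition orbit_tangent (u0 : Ya) : set Y :=
  [set w | exists2 xi, so3 xi & generator xi (j u0) w].

Definition is_relative_equilibrium (Phi : R -> Ya -> R -> option Ya)
    (u0 : Ya) (X0 : 'M[R]_3) : Prop :=
  [/\ forall t, 0 <= t -> Phi t u0 0 = Some (actYa (expm (t *: X0)) u0),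
      ~ (forall t, 0 <= t -> Phi t u0 0 = Some u0)
    & forall A, SO3 A -> actYa A u0 = u0 -> A = 1%:M].

(** [e] identifies the plane [V_*] with ['rV_2]. *)
Definition is_basis_of_Vstar (P : {linear Y -> Y}) (u0 : Ya)
    (e : {linear 'rV[R]_2 -> Y}) : Prop :=
  injective e /\
  range e = [set v | range P v /\ forall w, orbit_tangent u0 w -> dotY v w = 0].

Definition chart (Psi : 'rV[R]_2 -> Ya) (p : 'cV[R]_3 * 'rV[R]_2) : Ya :=
  actYa (expm (hat p.1)) (Psi p.2).

(** [(A, q) |-> A Psi(q)], with [q] in the ball of radius [delta], is a
    diffeomorphism onto a submanifold of [Ya] (injective immersion that is a
    homeomorphism onto its image; SO(3) is parametrized by the exponential), whose
    tangent space at [u0 = Psi(0)] is the range of [P]. *)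
Definition is_center_manifold_chart (M : nat) (P : {linear Y -> Y}) (u0 : Ya)
    (delta : R) (Psi : 'rV[R]_2 -> Ya) : Prop :=
  [/\ Psi 0 = u0,
      (forall A B q q', SO3 A -> SO3 B -> `|q| < delta -> `|q'| < delta ->
        actYa A (Psi q) = actYa B (Psi q') -> A = B /\ q = q'),
      (forall A q, SO3 A -> `|q| < delta -> forall eps, 0 < eps ->
        exists2 eta, 0 < eta & forall B q', SO3 B -> `|q'| < delta ->
          `|actYa B (Psi q') - actYa A (Psi q)| < eta ->
          `|B - A| < eps /\ `|q' - q| < eps),
      Ck M [set p : ('cV[R]_3 * 'rV[R]_2)%type | `|p.2| < delta] (chart Psi) /\
      (forall q, `|q| < delta -> injective ('d (chart Psi) (0, q)))
    & [set v | exists p, v = j ('d (chart Psi) (0, 0) p)] = range P].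

Definition is_reduced_solution (XG : 'rV[R]_2 * R -> 'M[R]_3)
    (XN : 'rV[R]_2 * R -> 'rV[R]_2) (l tau : R)
    (A : R -> 'M[R]_3) (q : R -> 'rV[R]_2) : Prop :=
  ode_on tau (fun t B => B *m XG (q t, l)) A /\
  ode_on tau (fun _ x => XN (x, l)) q.

Definition solutions_correspond (Phi : R -> Ya -> R -> option Ya)
    (Psi : 'rV[R]_2 -> Ya) (delta : R) (XG : 'rV[R]_2 * R -> 'M[R]_3)
    (XN : 'rV[R]_2 * R -> 'rV[R]_2) : Prop :=
  exists2 l1, 0 < l1 & forall l tau A q, `|l| < l1 -> 0 <= tau ->
    (forall t, 0 <= t <= tau -> SO3 (A t) /\ `|q t| < delta) ->
    (is_reduced_solution XG XN l tau A q <->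
     forall t, 0 <= t <= tau ->
       Phi t (actYa (A 0) (Psi (q 0))) l = Some (actYa (A t) (Psi (q t)))).

End Equation.

Section Hopf.
Context {R : realType}.

Definition least_period (W : Type) (x : R -> W) (T : R) : Prop :=
  [/\ 0 < T, forall t, 0 <= t -> x (t + T) = x t
    & forall s, 0 < s < T -> ~ forall t, 0 <= t -> x (t + s) = x t].

Definition near_orbit (g : R -> 'rV[R]_2) (y : 'rV[R]_2) (eps : R) : Prop :=
  exists2 s, 0 <= s & `|y - g s| < eps.

(* Asymptotic orbital stability. *)
Definition orbitally_stable (f : 'rV[R]_2 -> 'rV[R]_2) (g : R -> 'rV[R]_2) : Prop :=
  (forall eps, 0 < eps -> exists2 del, 0 < del & forall x,
     ode_halfline (fun _ => f) x -> near_orbit g (x 0) del ->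
     forall t, 0 <= t -> near_orbit g (x t) eps) /\
  (exists2 del, 0 < del & forall x,
     ode_halfline (fun _ => f) x -> near_orbit g (x 0) del ->
     forall eps, 0 < eps -> exists t0, forall t, t0 <= t -> 0 <= t ->
       near_orbit g (x t) eps).

Definition supercritical_Hopf (k : nat) (XN : 'rV[R]_2 * R -> 'rV[R]_2)
    (wbif l0 : R) (w : R -> R) (q : R -> R -> 'rV[R]_2) : Prop :=
  [/\ forall l, `|l| < l0 -> XN (0, l) = 0,
      wbif <> 0 /\ exists a b : R -> R,
        [/\ a 0 = 0, b 0 = 0, derivable a 0 1, 0 < derive1 a 0
          & forall l, `|l| < l0 -> forall z : R[i],
              eigenvalue (map_mx (fun x : R => x%:C%C)
                ('J (fun y : 'rV[R]_2 => XN (y, l)) 0)) z <->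
              z = (a l +i* (wbif + b l))%C \/ z = (a l -i* (wbif + b l))%C],
      [/\ CSt k l0 q, (forall t, 0 <= t -> q t 0 = 0) &
        exists C, forall t l, 0 <= t -> 0 <= l < l0 -> `|q t l| <= C * Num.sqrt l],
      CS k l0 w /\
      (exists C, forall l, 0 <= l < l0 -> `|w l - wbif| <= C * l)
    & forall l, 0 < l < l0 ->
      [/\ ode_halfline (fun _ x => XN (x, l)) (q^~ l),
          least_period (q^~ l) (2 * pi / `|w l|)
        & orbitally_stable (fun x => XN (x, l)) (q^~ l)]].

Context (Ya : Type) (act : 'M[R]_3 -> Ya -> Ya) (Phi : R -> Ya -> R -> option Ya).

Definition in_group_orbit (u : Ya) (v : option Ya) : Prop :=
  exists2 A, SO3 A & v = Some (act A u).

Definition is_relative_period (u : Ya) (l T : R) : Prop :=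
  [/\ 0 < T, in_group_orbit u (Phi T u l)
    & forall t, 0 < t < T -> ~ in_group_orbit u (Phi t u l)].

Definition is_primary_frequency (u : Ya) (l T : R) (X : 'M[R]_3) : Prop :=
  [/\ so3 X, is_relative_period u l T & Phi T u l = Some (act (expm (T *: X)) u)].

Definition is_modulated_rotating_wave (u : Ya) (l : R) : Prop :=
  exists T X, is_primary_frequency u l T X /\
    forall n : int, snorm X * T <> 2 * n%:~R * pi.

Definition Xperiod (w : R -> R) (Z : R -> R -> 'M[R]_3) (l : R) : 'M[R]_3 :=
  (`|w l| / (2 * pi)) *: Z (2 * pi / `|w l|) l.

Definition lifted (k : nat) (omega : R) (X : 'M[R]_3) : 'M[R]_3 :=
  ((snorm X + k%:R * `|omega|) / snorm X) *: X.

Definition nonresonant (X0 : 'M[R]_3) (wbif : R) : Prop :=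
  forall n : int, snorm X0 <> n%:~R * wbif.

Definition resonant (X0 : 'M[R]_3) (wbif : R) : Prop :=
  exists2 n : int, n <> 0 & snorm X0 = n%:~R * wbif.

End Hopf.

(* Main.v *)
Require Import Defs.
From HB Require Import structures.
From mathcomp Require Import all_boot all_order all_algebra.
From mathcomp Require Import all_classical all_reals all_analysis.
From mathcomp Require Import measurable_realfun ring lra.

Set Implicit Arguments.
Unset Strict Implicit.
Unset Printing Implicit Defensive.

Import Order.TTheory GRing.Theory Num.Theory.
Import numFieldNormedType.Exports.
Import HBNNSimple.

Local Open Scope classical_set_scope.
Local Open Scope ring_scope.

(** Everything is decided by one curve of rotations.  Let [T] be the period
    [2 pi / |omega|] of the Hopf solution [q].  At time [T] the solution through
    [Psi (q 0)] is back on the group orbit of its initial value, displaced by the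
    rotation [A T = exp (Z T)].  Hence [X] is a primary frequency as soon as [T] is
    the first return time and [exp (T X) = exp (Z T)].  The matrix [T X^f] is [Z T]
    with its norm raised by [2 pi k], that is, with [k] more full turns around the
    same axis, so its exponential is the right one ([lifted_frequency],
    [unit_frequency]).

    That [T] is the first return time follows from the skew product structure, with
    no appeal to uniqueness for differential equations.  If the solution meets the
    orbit at time [s], then [q s = q 0]; both [(A (t + s), q (t + s))] and
    [(A s A t, q t)] solve the reduced system and start at the same point of the
    center manifold, so they represent the same trajectory of the semiflow, and the
    injectivity of the chart gives [q (t + s) = q t] ([return_period]); [s] is then
    at least the least period.  In the same way the trajectory of the relative
    equilibrium shows that [A t = exp (t X0)] for [lambda = 0].  These arguments
    use that the identity matrix acts trivially on classes of functions, because a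
    class of functions that vanish almost everywhere is zero ([actYa1]).

    With [eps = sqrt lambda], the rotation [g eps = A T] is a C^m function of [eps]
    ([monodromy_ext]), and [g 0] is the rotation by [alpha_0] around the axis [n0]
    of [X0], because [T |X0| = alpha_0 + 2 pi k] at [lambda = 0].

    Without resonance, [alpha_0] lies strictly between [0] and [2 pi].  A rotation
    [S] by the angle [a] around [n] satisfies
    [S + S^T - (tr S - 1) = 2 (1 - cos a) n n^T], so that [n] is obtained by applying
    this matrix to [n0] and normalizing, and [a] by the half-angle formula
    [cot (a / 2) = sin a / (1 - cos a)].  These formulas ([axis], [angle]) are smooth
    near [g 0], and they recover the pair [(a, n)] or the pair [(2 pi - a, - n)]
    that describes the same rotation ([axis_angle_rot]); the second possibility is
    the jump of [q(D)] across the boundary of the hemisphere ([glued_polar]).  The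
    resulting branch is therefore CS, differentiability in [eps] at [0] gives the
    remainders [O(sqrt lambda)], and [0 < a < 2 pi] excludes periodic solutions
    ([nonresonant_branch]).

    In resonance [g 0] is the identity and the axis is lost, but the angle in
    [0, pi], equal to [2 atan (sqrt ((3 - tr) / (1 + tr)))], remains continuous; as
    [3 - tr (g eps) = O(eps)], it is [O(sqrt eps) = O(lambda^(1/4))]
    ([resonant_branch]). *)

(** * Classes of functions on the sphere *)

(** The integral is the supremum over the simple functions below [f], and these
    vanish almost everywhere.  The argument covers integrands whose measurability
    is unknown, such as those that contain the Laplacian of a test function. *)
Lemma ge0_integral_ae0 d (T : measurableType d) (R : realType)
    (mu : {measure set T -> \bar R}) (f : T -> \bar R) :
  (forall x, (0 <= f x)%E) -> {ae mu, forall x, f x = 0%E} ->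
  (\int[mu]_x f x)%E = 0%E.
Proof.
move=> f0 fae; rewrite ge0_integralTE//; apply/eqP; rewrite eq_le.
apply/andP; split; last first.
  by apply: ereal_sup_ubound => /=; exists nnsfun0 => //=; rewrite sintegral0.
apply: ge_ereal_sup => _ [h hf <-].
suff -> : sintegral mu h = 0%E by [].
have := integral_nnsfun mu measurableT h; rewrite patch_setT => <-.
rewrite (ae_eq_integral (cst 0%E)) ?integral_cst ?mul0e//.
  exact/measurable_EFinP.
apply: filterS fae => x fx _ /=.
have := hf x; rewrite fx lee_fin => hx0.
by congr (_%:E); apply/eqP; rewrite eq_le hx0 fun_ge0.
Qed.

Lemma Rintegral_ae0 d (T : measurableType d) (R : realType)
    (mu : {measure set T -> \bar R}) (D : set T) (f : T -> R) :
  {ae mu, forall x, D x -> f x = 0} -> \int[mu]_(x in D) f x = 0.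
Proof.
move=> f0; rewrite /Rintegral integral_mkcond integralE.
have f0' : {ae mu, forall x, ((EFin \o f) \_ D) x = 0%E}.
  apply: filterS f0 => x fx; rewrite patchE /=; case: ifPn => // /set_mem Dx.
  by rewrite fx.
rewrite !ge0_integral_ae0 ?sube0//.
- by apply: filterS f0' => x fx; rewrite funenegE fx oppe0 maxxx.
- by apply: filterS f0' => x fx; rewrite funeposE fx maxxx.
Qed.

Section Classes.
Context {R : realType} (r : R) (N : nat) (d : 'I_N -> R).

(** [leb2] as a bundled measure, so that its almost everywhere filter is found. *)
Definition leb2_measure : {measure set (measurableTypeR R * measurableTypeR R) -> \bar R} :=
  (@lebesgue_measure R \x @lebesgue_measure R)%E.

Lemma sphere_aeE (P : 'cV[R]_3 -> Prop) :
  sphere_ae r P = {ae leb2_measure, forall p, rect p -> P (sph r p.1 p.2)}.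
Proof. by []. Qed.

#[local] Instance leb2_filter : Filter (almost_everywhere leb2_measure).
Proof. exact: ae_filter_ringOfSetsType. Qed.

Lemma sphere_aeS (P Q : 'cV[R]_3 -> Prop) :
  (forall x, P x -> Q x) -> sphere_ae r P -> sphere_ae r Q.
Proof. by rewrite !sphere_aeE => PQ; apply: filterS => p Pp /Pp /PQ. Qed.

Lemma sphere_aeI (P Q : 'cV[R]_3 -> Prop) :
  sphere_ae r P -> sphere_ae r Q -> sphere_ae r (fun x => P x /\ Q x).
Proof.
rewrite !sphere_aeE => HP HQ.
by apply: filterS2 HP HQ => p Pp Qp rp; split; auto.
Qed.

Lemma sphere_int_ae0 (f : 'cV[R]_3 -> R) :
  sphere_ae r (fun x => f x = 0) -> sphere_int r f = 0.
Proof.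
rewrite !sphere_aeE => f0; apply: (@Rintegral_ae0 _ _ _ leb2_measure); apply: filterS f0 => p fp rp.
by rewrite fp// mul0r.
Qed.

Lemma sqint0 : sqint r (fun=> 0 : R).
Proof.
split; first exact: measurable_cst.
rewrite (_ : (fun _ => _) = cst 0%E); last first.
  by apply/funext => p; rewrite expr2 !mul0r.
exact: integrable0.
Qed.

Context (Y : completeNormedModType R) (rep : Y -> 'cV[R]_3 -> 'cV[R]_N).
Hypothesis hY : is_model_of_Y r d rep.

(** The norm of [Y] is determined by the representative.  In the [H^2] case the
    zero function is a weak Laplacian of a function that vanishes almost
    everywhere. *)
Lemma model_rep_ae0 (u : Y) : sphere_ae r (fun x => rep u x = 0) -> u = 0.
Proof.
move=> u0; case: hY => _ _ /(_ u) [nu1 nu2] _.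
have ui0 i : sphere_ae r (fun x => rep u x i 0 = 0).
  by apply: sphere_aeS u0 => x ->; rewrite mxE.
suff : `|u| ^+ 2 = 0 by move=> /eqP; rewrite sqrf_eq0 normr_eq0 => /eqP.
have [dp|dp] := pselect (forall i, 0 < d i).
  rewrite nu1// big1// => i _; apply: sphere_int_ae0.
  by apply: sphere_aeS (ui0 i) => x ->; rewrite expr2 mulr0.
rewrite (nu2 dp (fun _ _ => 0)); last first.
  move=> i; split; first exact: sqint0.
  move=> phi _; rewrite !sphere_int_ae0//.
  - by apply: sphere_aeS (ui0 i) => x ->; rewrite mul0r.
  - by apply: sphere_aeS (ui0 i) => x _; rewrite mul0r.
rewrite big1// => i _; apply: sphere_int_ae0.
by apply: sphere_aeS (ui0 i) => x ->; rewrite subr0 expr2 mulr0.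
Qed.

Lemma model_rep_inj (u v : Y) :
  sphere_ae r (fun x => rep u x = rep v x) -> u = v.
Proof.
case: (hY) => _ repL _ _ uv; apply/eqP; rewrite -subr_eq0 addrC -scaleN1r.
apply/eqP/model_rep_ae0.
apply: sphere_aeS (sphere_aeI (repL (-1) v u) uv) => x [-> ->].
by rewrite scaleN1r addNr.
Qed.

Context (al : R) (Ya : completeNormedModType R) (j : {linear Ya -> Y}).
Hypothesis hYa : is_model_of_Yal r d al rep j.

(** The norm of an element of [Y^alpha] is that of its fractional power, and [0] is
    a fractional power of [0]. *)
Lemma model_emb_inj : injective j.
Proof.
move=> a b jab; apply/eqP; rewrite -subr_eq0 -normr_eq0.
have j0 : j (a - b) = 0 by rewrite linearB jab subrr.
case: hYa => _ /(_ (a - b) 0) ->; first by rewrite normr0.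
have rep0 : sphere_ae r (fun x => rep 0 x = 0).
  case: (hY) => _ /(_ 1 0 0) H _ _.
  apply: sphere_aeS H => x; rewrite scaler0 addr0 scale1r => /eqP.
  by rewrite -[X in X == _]addr0 (inj_eq (addrI _)) eq_sym => /eqP.
move=> i nu phi _; rewrite j0 /pairing.
have -> : sphere_int r (fun x => rep 0 x i 0 * phi x) = 0.
  by apply: sphere_int_ae0; apply: sphere_aeS rep0 => x ->; rewrite mxE mul0r.
by rewrite mulr0.
Qed.

Lemma actYa1 (u : Ya) : actYa r rep j 1%:M u = u.
Proof.
rewrite /actYa /rotation_act; case: xgetP => [v _ /=|/(_ u)[]/=].
  rewrite invmx1 => vu; apply/model_emb_inj/model_rep_inj.
  by apply: sphere_aeS vu => x; rewrite mul1mx.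
rewrite invmx1 sphere_aeE; apply: filterE.
by move=> p _; rewrite mul1mx.
Qed.

End Classes.

(** * Calculus of maps of class C^k *)

Section CkTheory.
Context {R : realType}.
Implicit Types (U V W : normedModType R) (k : nat).

(** The differential depends on the germ only; this is what lets the tangent maps
    below be computed on open sets. *)
Lemma near_eq_diff V W (f g : V -> W) (x : V) :
  (\forall y \near x, f y = g y) -> differentiable f x ->
  differentiable g x /\ ('d g x : V -> W) = 'd f x.
Proof.
move=> fg df.
have dgo : g \o shift x = cst (g x) + 'd f x +o_ 0 id.
  apply/eqaddoP => e e0; have /eqaddoP/(_ e e0) := diff_locally df.
  rewrite -(nbhs_singleton fg).
  have : \forall y \near 0, f (y + x) = g (y + x).
    by move: fg; rewrite (near_shift 0 x) subr0.
  by apply: filterS2 => y /= fgy; rewrite /= !fctE /= fgy.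
have dg : 'd g x = 'd f x :> (V -> W).
  by apply: diff_unique; first exact: diff_continuous.
split => //.
by apply/diff_locallyP; rewrite dg; split => //; exact: diff_continuous.
Qed.

Lemma CkW k V W (A : set V) (f : V -> W) : Ck k.+1 A f -> Ck k A f.
Proof.
elim: k V W A f => [|k IH] V W A f /= [df Tf].
  by move=> x Ax; exact: differentiable_continuous (df x Ax).
by split => //; exact: IH.
Qed.

Lemma Ck_sub k V W (A B : set V) (f : V -> W) :
  B `<=` A -> Ck k A f -> Ck k B f.
Proof.
elim: k V W A B f => [|k IH] V W A B f BA /=; first by move=> cf x /BA; exact: cf.
move=> [df Tf]; split; first by move=> x /BA; exact: df.
by apply: IH Tf => p /BA.
Qed.

Lemma Ck_cont k V W (A : set V) (f : V -> W) x :
  Ck k A f -> A x -> {for x, continuous f}.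
Proof.
case: k => [|k] /=; first by move=> + Ax; apply.
by move=> [df _] /df; exact: differentiable_continuous.
Qed.

Lemma open_fst V W (A : set V) : open A -> open [set p : (V * W)%type | A p.1].
Proof. by move=> oA; apply: open_comp => // p _; exact: cvg_fst. Qed.

Lemma Ck_ext k V W (A : set V) (f g : V -> W) : open A ->
  (forall x, A x -> f x = g x) -> Ck k A f -> Ck k A g.
Proof.
elim: k V W A f g => [|k IH] V W A f g oA fg /=.
  move=> cf x Ax; have fgx : \forall y \near x, f y = g y.
    by apply: filterS (open_nbhs_nbhs (conj oA Ax)) => y /fg.
  rewrite /prop_for /continuous_at -(fg x Ax).
  apply: cvg_trans (cf x Ax); apply: near_eq_cvg.
  by apply: filterS fgx.
move=> [df Tf].
have fgx x : A x -> differentiable g x /\ ('d g x : V -> W) = 'd f x.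
  move=> Ax; apply: near_eq_diff (df x Ax).
  by apply: filterS (open_nbhs_nbhs (conj oA Ax)) => y /fg.
split; first by move=> x /fgx[].
apply: IH Tf; first exact: open_fst.
by move=> p Ap; exact: (congr1 (@^~ p.2) (esym (fgx _ Ap).2)).
Qed.

Lemma Ck_cst k V W (A : set V) (c : W) : Ck k A (fun=> c).
Proof.
elim: k V W A c => [|k IH] V W A c /=; first by move=> x _; exact: cvg_cst.
split; first by move=> x _; exact: differentiable_cst.
rewrite (_ : (fun _ => _) = fun=> 0); first exact: IH.
by apply/funext => p; rewrite -[fun=> c]/(cst c) diff_cst.
Qed.

Lemma Ck_lin k V W (A : set V) (f : {linear V -> W}) :
  continuous f -> Ck k A f.
Proof.
elim: k V W A f => [|k IH] V W A f cf /=; first by move=> x _; exact: cf.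
split; first by move=> x _; exact: linear_differentiable.
rewrite (_ : (fun _ => _) = [the {linear (V * V)%type -> W} of f \o snd]).
  by apply: IH => p; apply: continuous_comp; [exact: cvg_snd|exact: cf].
by apply/funext => p /=; rewrite diff_lin.
Qed.

Lemma Ck_linear k V W (A : set V) (f : V -> W) :
  linear f -> continuous f -> Ck k A f.
Proof.
move=> lf cf; pose fM := GRing.isLinear.Build _ _ _ _ _ lf.
pose fL : {linear _ -> _} := HB.pack f fM.
exact: (@Ck_lin k _ _ A fL).
Qed.

Lemma Ck_pair k U V W (A : set U) (f : U -> V) (g : U -> W) :
  open A -> Ck k A f -> Ck k A g -> Ck k A (fun x => (f x, g x)).
Proof.
elim: k U V W A f g => [|k IH] U V W A f g oA /=.
  by move=> cf cg x Ax; apply: cvg_pair; [exact: cf|exact: cg].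
move=> [df Tf] [dg Tg]; split.
  by move=> x Ax; apply: differentiable_pair; auto.
apply: (@Ck_ext _ _ _ _ (fun p : U * U => ('d f (p.1) p.2, 'd g (p.1) p.2))).
- exact: open_fst.
- by move=> p /= Ap; rewrite diff_pair; auto.
- by apply: IH => //; exact: open_fst.
Qed.

(** Induction on [k] through the chain rule in tangent form: the tangent map of
    [g \o f] is the tangent map of [g] composed with
    [(x, v) |-> (f x, 'd f x v)], and both are of class C^k. *)
Lemma Ck_comp k U V W (A : set U) (B : set V) (f : U -> V) (g : V -> W) :
  open A -> open B -> (forall x, A x -> B (f x)) ->
  Ck k A f -> Ck k B g -> Ck k A (g \o f).
Proof.
elim: k U V W A B f g => [|k IH] U V W A B f g oA oB AB.
  move=> cf cg x Ax.
  by apply: continuous_comp; [exact: cf|exact: cg (f x) (AB x Ax)].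
move=> Cf; have Cf' := CkW Cf; case: Cf => df Tf [dg Tg]; split.
  by move=> x Ax; apply: differentiable_comp; auto.
apply: (@Ck_ext _ _ _ _ ((fun p : V * V => 'd g (p.1) p.2) \o
  (fun p : U * U => (f p.1, 'd f (p.1) p.2)))).
- exact: open_fst.
- by move=> p /= Ap; rewrite (diff_comp (df _ Ap) (dg _ (AB _ Ap))).
- apply: (IH _ _ _ _ [set p | B p.1]) => //; [exact: open_fst|exact: open_fst|..].
  + by move=> p /= /AB.
  + apply: Ck_pair => //; first exact: open_fst.
    apply: (IH _ _ _ _ A fst f) => //; first exact: open_fst.
    by apply: Ck_linear => // p; exact: cvg_fst.
Qed.

Lemma CkD k V W (A : set V) (f g : V -> W) :
  open A -> Ck k A f -> Ck k A g -> Ck k A (fun x => f x + g x).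
Proof.
move=> oA cf cg; have cfg := Ck_pair oA cf cg.
apply: (@Ck_comp _ _ _ _ A setT (fun x => (f x, g x)) (fun p : W * W => p.1 + p.2)
  oA openT _ cfg) => //.
apply: Ck_linear => [a u v /=|]; last exact: add_continuous.
by rewrite scalerDr addrACA.
Qed.

(** The tangent map of the product is again a sum of products of coordinates. *)
Lemma Ck_mul k : Ck k setT (fun p : R * R => p.1 * p.2).
Proof.
elim: k => [|k IH] /=; first by move=> p _; exact: mul_continuous.
split; first by move=> p _; apply: ex_diff.
rewrite (_ : [set _ | _] = setT); last exact/seteqP.
rewrite (_ : (fun _ => _) =
  fun p : (R * R) * (R * R) => p.1.1 * p.2.2 + p.2.1 * p.1.2); last first.
  by apply/funext => p; rewrite diff_val.
have prj (f : (R * R) * (R * R) -> R * R) : linear f -> continuous f ->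
    Ck k setT (fun p => (f p).1 * (f p).2).
  move=> lf cf; exact: (@Ck_comp k _ _ _ setT setT f (fun p : R * R => p.1 * p.2)
    openT openT (fun _ _ => I) (Ck_linear _ _ lf cf)).
apply: CkD; first exact: openT.
- apply: (prj (fun p => (p.1.1, p.2.2))) => // p.
  exact: (cvg_pair (cvg_comp _ _ cvg_fst cvg_fst) (cvg_comp _ _ cvg_snd cvg_snd)).
- apply: (prj (fun p => (p.2.1, p.1.2))) => // p.
  exact: (cvg_pair (cvg_comp _ _ cvg_snd cvg_fst) (cvg_comp _ _ cvg_fst cvg_snd)).
Qed.

Lemma CkM k V (A : set V) (f g : V -> R) :
  open A -> Ck k A f -> Ck k A g -> Ck k A (fun x => f x * g x).
Proof.
move=> oA cf cg; have cfg := Ck_pair oA cf cg.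
exact: (Ck_comp (B := setT) oA openT _ cfg (Ck_mul k)).
Qed.

(** The bridge from derivatives of real functions to tangent maps, which reduces
    the smoothness of inverse, square root and arctangent to that of their
    derivatives. *)
Lemma Ck_deriv k (A : set R) (f f' : R -> R) : open A ->
  (forall x, A x -> is_derive x (1 : R) f (f' x)) -> Ck k A f' -> Ck k.+1 A f.
Proof.
move=> oA df cf' /=.
have dfA x : A x -> differentiable f x.
  by move=> /df ?; apply/derivable1_diffP.
split => //; apply: (@Ck_ext _ _ _ _ (fun p : R * R => p.2 * f' p.1)).
- exact: open_fst.
- move=> p /= Ap; rewrite diff1E; last exact: dfA.
  by rewrite derive1E (@derive_val _ _ _ _ _ _ _ (df _ Ap)).
- have oA1 : open [set p : R * R | A p.1] by exact: open_fst.
  apply: CkM => //; first by apply: Ck_linear => // p; exact: cvg_snd.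
  apply: (@Ck_comp _ _ _ _ _ A fst f') => //.
  by apply: Ck_linear => // p; exact: cvg_fst.
Qed.

Lemma Ck_inv k : Ck k [set x : R | x != 0] (fun x => x^-1).
Proof.
have o0 : open [set x : R | x != 0] by exact: open_neq.
elim: k => [|k IH]; first by move=> x x0; exact: inv_continuous.
apply: (@Ck_deriv _ _ _ (fun x => -1 * (x^-1 * x^-1))) => //.
  move=> x x0; apply: is_derive_eq; first exact: is_deriveV.
  by rewrite /= mulN1r -exprVn expr2 scaler1.
by apply: CkM => //; [exact: Ck_cst|exact: CkM].
Qed.

Lemma Ck_sqrt k : Ck k [set x : R | 0 < x] (@Num.sqrt R).
Proof.
have o0 : open [set x : R | 0 < x] by exact: open_gt.
have on0 : open [set x : R | x != 0] by exact: open_neq.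
elim: k => [|k IH]; first by move=> x _; exact: sqrt_continuous.
apply: (@Ck_deriv _ _ _ (fun x => (2 * Num.sqrt x)^-1)) => //.
apply: (@Ck_comp k R R R _ [set x : R | x != 0] (fun x : R => 2 * Num.sqrt x)
  (fun x => x^-1) o0 on0).
- by move=> x /= x0; rewrite mulf_neq0// ?pnatr_eq0// gt_eqF// sqrtr_gt0.
- by apply: CkM => //; exact: Ck_cst.
- exact: Ck_inv.
Qed.

Lemma Ck_atan k : Ck k setT (@atan R).
Proof.
have on0 : open [set x : R | x != 0] by exact: open_neq.
case: k => [|k]; first by move=> x _; exact: continuous_atan.
apply: (@Ck_deriv _ _ _ (fun x => (1 + x ^+ 2)^-1)); first exact: openT.
apply: (@Ck_comp k R R R _ [set x : R | x != 0] (fun x : R => 1 + x ^+ 2)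
  (fun x => x^-1) openT on0).
- by move=> x _; rewrite /= gt_eqF// ltr_pwDl// sqr_ge0.
- apply: CkD; [exact: openT|exact: Ck_cst|].
  have -> : (fun x : R => x ^+ 2) = fun x => x * x by apply/funext => x; rewrite expr2.
  by apply: CkM; [exact: openT|apply: Ck_linear|apply: Ck_linear] => // x;
    exact: cvg_id.
- exact: Ck_inv.
Qed.

(** Smoothness near a point: with this form the open domains of composite maps
    need not be carried around. *)
Definition Ck_at k V W (x : V) (f : V -> W) :=
  exists A : set V, [/\ open A, A x & Ck k A f].

Lemma Ck_at_cont k V W (x : V) (f : V -> W) :
  Ck_at k x f -> {for x, continuous f}.
Proof. by move=> [A [oA Ax CA]]; exact: Ck_cont CA Ax. Qed.

Lemma Ck_at_diff k V W (x : V) (f : V -> W) :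
  Ck_at k.+1 x f -> differentiable f x.
Proof. by move=> [A [oA Ax [dA _]]]; exact: dA. Qed.

Lemma Ck_at_comp k U V W (x : U) (f : U -> V) (g : V -> W) :
  Ck_at k x f -> Ck_at k (f x) g -> Ck_at k x (g \o f).
Proof.
move=> [A [oA Ax CA]] [B [oB Bfx CB]].
have oAB : open (A `&` f @^-1` B).
  rewrite openE => y [Ay By]; apply: filterI; first exact: open_nbhs_nbhs.
  by apply: (Ck_cont CA Ay); exact: open_nbhs_nbhs.
exists (A `&` f @^-1` B); split => //.
apply: (Ck_comp oAB oB) CB; first by move=> y [].
by apply: Ck_sub CA => y [].
Qed.

Lemma Ck_at_pair k U V W (x : U) (f : U -> V) (g : U -> W) :
  Ck_at k x f -> Ck_at k x g -> Ck_at k x (fun y => (f y, g y)).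
Proof.
move=> [A [oA Ax CA]] [B [oB Bx CB]].
have oAB : open (A `&` B) by exact: openI.
exists (A `&` B); split => //.
by apply: Ck_pair => //; [apply: Ck_sub CA => y []|apply: Ck_sub CB => y []].
Qed.

Lemma Ck_at_linear k V W (x : V) (f : V -> W) :
  linear f -> continuous f -> Ck_at k x f.
Proof. by move=> lf cf; exists setT; split => //; [exact: openT|exact: Ck_linear]. Qed.

Lemma Ck_at_cst k V W (x : V) (c : W) : Ck_at k x (fun=> c).
Proof. by exists setT; split => //; [exact: openT|exact: Ck_cst]. Qed.

Lemma Ck_at_id k V (x : V) : Ck_at k x id.
Proof. by apply: Ck_at_linear => // y; exact: cvg_id. Qed.

Lemma Ck_at_set k V W (A : set V) (f : V -> W) x :
  open A -> Ck k A f -> A x -> Ck_at k x f.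
Proof. by exists A. Qed.

Lemma Ck_atD k V W (x : V) (f g : V -> W) :
  Ck_at k x f -> Ck_at k x g -> Ck_at k x (fun y => f y + g y).
Proof.
move=> cf cg; apply: (@Ck_at_comp _ _ _ _ x (fun y => (f y, g y))
  (fun p : W * W => p.1 + p.2)); first exact: Ck_at_pair.
apply: Ck_at_linear => [a u v /=|]; last exact: add_continuous.
by rewrite scalerDr addrACA.
Qed.

Lemma Ck_at_sum k V W (I : Type) (s : seq I) (x : V) (f : I -> V -> W) :
  (forall i, Ck_at k x (f i)) -> Ck_at k x (fun y => \sum_(i <- s) f i y).
Proof.
move=> cf; elim: s => [|i s IH].
  by under eq_fun do rewrite big_nil; exact: Ck_at_cst.
by under eq_fun do rewrite big_cons; exact: Ck_atD.
Qed.

Lemma Ck_atM k V (x : V) (f g : V -> R) :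
  Ck_at k x f -> Ck_at k x g -> Ck_at k x (fun y => f y * g y).
Proof.
move=> cf cg; exact: (Ck_at_comp (Ck_at_pair cf cg)
  (Ck_at_set openT (Ck_mul k) (I : setT (f x, g x)))).
Qed.

Lemma Ck_atZ k V W (x : V) (c : R) (f : V -> W) :
  Ck_at k x f -> Ck_at k x (fun y => c *: f y).
Proof.
move=> cf; apply: (@Ck_at_comp _ _ _ _ x f ( *:%R c)) => //.
apply: Ck_at_linear => [a u v /=|]; last exact: scaler_continuous.
by rewrite scalerDr !scalerA mulrC.
Qed.

Lemma Ck_atZl k V W (x : V) (f : V -> R) (w : W) :
  Ck_at k x f -> Ck_at k x (fun y => f y *: w).
Proof.
move=> cf; apply: (@Ck_at_comp _ _ _ _ x f ( *:%R^~ w)) => //.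
apply: Ck_at_linear => [a u v /=|]; last exact: scalel_continuous.
by rewrite scalerDl scalerA.
Qed.

Lemma Ck_atN k V W (x : V) (f : V -> W) :
  Ck_at k x f -> Ck_at k x (fun y => - f y).
Proof. by move=> /(@Ck_atZ _ _ _ _ (-1)); under eq_fun do rewrite scaleN1r. Qed.

Lemma Ck_atB k V W (x : V) (f g : V -> W) :
  Ck_at k x f -> Ck_at k x g -> Ck_at k x (fun y => f y - g y).
Proof. by move=> cf cg; apply: Ck_atD => //; exact: Ck_atN. Qed.

Lemma Ck_atV k V (x : V) (f : V -> R) :
  f x != 0 -> Ck_at k x f -> Ck_at k x (fun y => (f y)^-1).
Proof.
have on0 : open [set x : R | x != 0] by exact: open_neq.
move=> fx cf; exact: (Ck_at_comp cf (Ck_at_set on0 (Ck_inv k) fx)).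
Qed.

Lemma Ck_at_sqrt k V (x : V) (f : V -> R) :
  0 < f x -> Ck_at k x f -> Ck_at k x (fun y => Num.sqrt (f y)).
Proof.
have o0 : open [set x : R | 0 < x] by exact: open_gt.
move=> fx cf; exact: (Ck_at_comp cf (Ck_at_set o0 (Ck_sqrt k) fx)).
Qed.

Lemma Ck_at_atan k V (x : V) (f : V -> R) :
  Ck_at k x f -> Ck_at k x (fun y => atan (f y)).
Proof.
move=> cf.
exact: (Ck_at_comp cf (Ck_at_set openT (Ck_atan k) (I : setT (f x)))).
Qed.

Lemma Ck_at_coord k V m n (x : V) (f : V -> 'M[R]_(m, n)) i j :
  Ck_at k x f -> Ck_at k x (fun y => f y i j).
Proof.
move=> cf; apply: (@Ck_at_comp _ _ _ _ x f (fun M : 'M[R]_(m, n) => M i j)) => //.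
apply: Ck_at_linear; last exact: coord_continuous.
by move=> a u v /=; rewrite !mxE.
Qed.

Lemma diff_bigO W (f : R -> W) : differentiable f (0 : R) ->
  exists2 C, 0 < C & \forall h \near (0 : R), `|f h - f 0| <= C * `|h|.
Proof.
move=> df; exists (1 + `|'d f 0 1|); first by rewrite ltr_pwDl.
have /eqaddoP/(_ 1 ltr01) := diff_locally df.
apply: filterS => h /=; rewrite !fctE /= addr0 => fh.
rewrite -(subrK ('d f 0 h) (f h - f 0)) (le_trans (ler_normD _ _))//.
rewrite mulrDl lerD//; first by rewrite -addrA -opprD.
by rewrite -{1}[h]mulr1 linearZ normrZ mulrC.
Qed.

End CkTheory.

(** * Rotations and antisymmetric matrices *)

Section Rotations3.
Context {R : realType}.
Implicit Types (u v n : 'cV[R]_3) (X Y Z A : 'M[R]_3).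

Lemma forall_I3 (P : 'I_3 -> Prop) : P 0 -> P 1 -> P 2 -> forall i, P i.
Proof.
move=> P0 P1 P2 [[|[|[|//]]] Hi].
- by rewrite (_ : Ordinal Hi = 0)//; exact: val_inj.
- by rewrite (_ : Ordinal Hi = 1)//; exact: val_inj.
- by rewrite (_ : Ordinal Hi = 2)//; exact: val_inj.
Qed.

Lemma sum_I3 (V : nmodType) (F : 'I_3 -> V) : \sum_i F i = F 0 + F 1 + F 2.
Proof.
rewrite !big_ord_recl big_ord0 addr0 addrA; congr (_ + F _ + F _); exact: val_inj.
Qed.

Lemma I3D : ((0 + 1 = 1 :> 'I_3)%R * (1 + 1 = 2 :> 'I_3)%R *
  (2 + 1 = 0 :> 'I_3)%R * (0 + 2 = 2 :> 'I_3)%R * (1 + 2 = 0 :> 'I_3)%R *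
  (2 + 2 = 1 :> 'I_3)%R)%type.
Proof. by do !split; exact: val_inj. Qed.

Lemma colP3 u v : u 0 0 = v 0 0 -> u 1 0 = v 1 0 -> u 2 0 = v 2 0 -> u = v.
Proof.
by move=> *; apply/matrixP => i j; rewrite ord1; move: i; exact: forall_I3.
Qed.

(** Explicit matrices, on which identities are reduced to identities between
    entries. *)
Definition mx3 (a b c d e f g h k : R) : 'M[R]_3 :=
  \matrix_(i < 3, j < 3) nth 0 (nth [::] [:: [:: a; b; c]; [:: d; e; f]; [:: g; h; k]] i) j.

Lemma mx3P A : A = mx3 (A 0 0) (A 0 1) (A 0 2) (A 1 0) (A 1 1) (A 1 2) (A 2 0) (A 2 1) (A 2 2).
Proof.
by apply/matrixP; apply: forall_I3; apply: forall_I3; rewrite mxE.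
Qed.

Lemma mx3_congr (a b c d e f g h k a' b' c' d' e' f' g' h' k' : R) :
  [/\ a = a', b = b' & c = c'] -> [/\ d = d', e = e' & f = f'] ->
  [/\ g = g', h = h' & k = k'] ->
  mx3 a b c d e f g h k = mx3 a' b' c' d' e' f' g' h' k'.
Proof. by move=> [-> -> ->] [-> -> ->] [-> -> ->]. Qed.

Lemma mx3D a b c d e f g h k a' b' c' d' e' f' g' h' k' :
  mx3 a b c d e f g h k + mx3 a' b' c' d' e' f' g' h' k' =
  mx3 (a + a') (b + b') (c + c') (d + d') (e + e') (f + f') (g + g') (h + h') (k + k').
Proof. by rewrite [LHS]mx3P !mxE. Qed.

Lemma mx3N a b c d e f g h k :
  - mx3 a b c d e f g h k = mx3 (- a) (- b) (- c) (- d) (- e) (- f) (- g) (- h) (- k).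
Proof. by rewrite [LHS]mx3P !mxE. Qed.

Lemma mx3Z x a b c d e f g h k :
  x *: mx3 a b c d e f g h k =
  mx3 (x * a) (x * b) (x * c) (x * d) (x * e) (x * f) (x * g) (x * h) (x * k).
Proof. by rewrite [LHS]mx3P !mxE. Qed.

Lemma mx3T a b c d e f g h k :
  (mx3 a b c d e f g h k)^T = mx3 a d g b e h c f k.
Proof. by rewrite [LHS]mx3P !mxE. Qed.

Lemma mx3M a b c d e f g h k a' b' c' d' e' f' g' h' k' :
  mx3 a b c d e f g h k *m mx3 a' b' c' d' e' f' g' h' k' =
  mx3 (a * a' + b * d' + c * g') (a * b' + b * e' + c * h') (a * c' + b * f' + c * k')
      (d * a' + e * d' + f * g') (d * b' + e * e' + f * h') (d * c' + e * f' + f * k')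
      (g * a' + h * d' + k * g') (g * b' + h * e' + k * h') (g * c' + h * f' + k * k').
Proof. by rewrite [LHS]mx3P !mxE !sum_I3 !mxE. Qed.

Lemma mx3_scalar x : x%:M = mx3 x 0 0 0 x 0 0 0 x.
Proof. by rewrite [LHS]mx3P !mxE. Qed.

Lemma hatE u : hat u = mx3 0 (- u 2 0) (u 1 0) (u 2 0) 0 (- u 0 0) (- u 1 0) (u 0 0) 0.
Proof.
rewrite [LHS]mx3P !mxE !I3D /= !mulr1 !mulr0 !(subr0, sub0r).
by apply: mx3_congr.
Qed.

Definition mx3E := (mx3_scalar, mx3D, mx3N, mx3Z, mx3T, mx3M).

Lemma hatK u : vec (hat u) = u.
Proof. by apply: colP3; rewrite mxE !I3D hatE !mxE. Qed.

Lemma vecK X : so3 X -> hat (vec X) = X.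
Proof.
move=> /matrixP sX.
have H i j : X j i = - X i j by have := sX i j; rewrite !mxE.
have D i : X i i = 0 by apply/eqP; have := H i i; lra.
rewrite hatE !mxE !I3D [RHS]mx3P.
by apply: mx3_congr; split; rewrite ?D// ?[RHS]H// opprK.
Qed.

Lemma hat_so3 u : so3 (hat u).
Proof. by rewrite /so3 !hatE !mx3E; apply: mx3_congr; split; rewrite ?oppr0 ?opprK. Qed.

Lemma hatZ a u : hat (a *: u) = a *: hat u.
Proof. by rewrite !hatE mx3E !mxE; apply: mx3_congr; split; ring. Qed.

Lemma vecZ a X : vec (a *: X) = a *: vec X.
Proof. by apply/matrixP => i j; rewrite !mxE. Qed.

Lemma so3Z a X : so3 X -> so3 (a *: X).
Proof. by rewrite /so3 => sX; rewrite linearZ /= sX scalerN. Qed.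

Lemma dot3E u v : dot3 u v = u 0 0 * v 0 0 + u 1 0 * v 1 0 + u 2 0 * v 2 0.
Proof. exact: sum_I3. Qed.

Lemma dot3Zl a u v : dot3 (a *: u) v = a * dot3 u v.
Proof. by rewrite !dot3E !mxE; ring. Qed.

Lemma dot3Zr a u v : dot3 u (a *: v) = a * dot3 u v.
Proof. by rewrite !dot3E !mxE; ring. Qed.

Lemma dot3_ge0 u : 0 <= dot3 u u.
Proof. by rewrite dot3E !addr_ge0// -expr2 sqr_ge0. Qed.

Lemma dot3_eq0 u : dot3 u u = 0 -> u = 0.
Proof.
rewrite dot3E -!expr2 => H.
have [x0 y0 z0] : [/\ u 0 0 = 0, u 1 0 = 0 & u 2 0 = 0].
  by split; apply/eqP; rewrite -sqrf_eq0; apply/eqP; nra.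
by apply: colP3; rewrite mxE.
Qed.

Lemma snormZ a X : snorm (a *: X) = `|a| * snorm X.
Proof.
rewrite /snorm /enorm vecZ dot3Zl dot3Zr mulrA -expr2 sqrtrM ?sqr_ge0//.
by rewrite sqrtr_sqr.
Qed.

Lemma snorm_ge0 X : 0 <= snorm X. Proof. exact: sqrtr_ge0. Qed.

Lemma snorm_eq0 X : so3 X -> snorm X = 0 -> X = 0.
Proof.
move=> sX /eqP; rewrite /snorm /enorm sqrtr_eq0 => H.
have /dot3_eq0 v0 : dot3 (vec X) (vec X) = 0 by apply/eqP; rewrite eq_le H dot3_ge0.
by rewrite -(vecK sX) v0 -[0 in LHS](scale0r 0) hatZ scale0r.
Qed.

Lemma snorm0 : snorm (0 : 'M[R]_3) = 0.
Proof. by rewrite -[0 in LHS](scale0r 0) snormZ normr0 mul0r. Qed.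

Lemma snorm_hat u : dot3 u u = 1 -> snorm (hat u) = 1.
Proof. by move=> u1; rewrite /snorm hatK /enorm u1 sqrtr1. Qed.

(** Every nonzero antisymmetric matrix is its norm times [hat] of a unit vector,
    so that Rodrigues' formula applies to it. *)
Lemma so3_polar X : so3 X -> X <> 0 ->
  let n := (snorm X)^-1 *: vec X in
  [/\ 0 < snorm X, dot3 n n = 1 & X = snorm X *: hat n].
Proof.
move=> sX X0 /=.
have s0 : 0 < snorm X.
  by rewrite lt_def snorm_ge0 andbT; apply/eqP => /(snorm_eq0 sX).
split => //.
  rewrite dot3Zl dot3Zr mulrA -(sqr_sqrtr (dot3_ge0 (vec X))) -/(snorm X).
  by rewrite -invfM -expr2 mulVf// gt_eqF// exprn_gt0.
by rewrite hatZ vecK// scalerA divff ?gt_eqF// scale1r.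
Qed.

(** Rodrigues' formula: the rotation by the angle [th] around [n]. *)
Definition rotmx (th : R) n : 'M[R]_3 :=
  1%:M + sin th *: hat n + (1 - cos th) *: (hat n *m hat n).

Lemma rotmxE th n : dot3 n n = 1 ->
  let s := sin th in let c := cos th in
  let x := n 0 0 in let y := n 1 0 in let z := n 2 0 in
  rotmx th n = mx3 (c + (1 - c) * x * x) ((1 - c) * x * y - s * z) ((1 - c) * x * z + s * y)
                 ((1 - c) * x * y + s * z) (c + (1 - c) * y * y) ((1 - c) * y * z - s * x)
                 ((1 - c) * x * z - s * y) ((1 - c) * y * z + s * x) (c + (1 - c) * z * z).
Proof.
rewrite dot3E => n1 s c x y z.
have K : (1 - c) * (x * x + y * y + z * z) = 1 - c by rewrite n1 mulr1.
rewrite /rotmx !hatE !mx3E -/s -/c -/x -/y -/z.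
by apply: mx3_congr; split; lra.
Qed.

Lemma trace3 A : \tr A = A 0 0 + A 1 1 + A 2 2.
Proof. exact: sum_I3. Qed.

Lemma rotmx_tr th n : dot3 n n = 1 -> \tr (rotmx th n) = 1 + 2 * cos th.
Proof.
move=> n1; rewrite rotmxE// trace3 !mxE /=; move: n1; rewrite dot3E => n1.
have K := congr1 (fun t => (1 - cos th) * t) n1; rewrite /= in K.
by lra.
Qed.

(** The Cayley-Hamilton identity for [hat n]: it makes the span of [1], [hat n] and
    its square an algebra, on which Rodrigues' formula is computed. *)
Lemma hat_cube n : dot3 n n = 1 -> hat n *m (hat n *m hat n) = - hat n.
Proof.
rewrite dot3E => n1; rewrite !hatE !mx3E.
move: n1; move: (n 0 0) (n 1 0) (n 2 0) => x y z n1.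
have K t : t * (x * x + y * y + z * z) = t by rewrite n1 mulr1.
have := K x; have := K y; have := K z => Kx Ky Kz.
by apply: mx3_congr; split; lra.
Qed.

Lemma rotmxD a b n : dot3 n n = 1 -> rotmx a n *m rotmx b n = rotmx (a + b) n.
Proof.
move=> /hat_cube; rewrite /rotmx sinD cosD; move: (hat n) => N.
have [N2 N2E] : exists N2, N2 = N *m N by exists (N *m N).
rewrite -N2E => N3.
have N3' : N2 *m N = - N by rewrite N2E -mulmxA -N2E.
have N4 : N2 *m N2 = - N2 by rewrite {1}N2E -mulmxA N3 mulmxN -N2E.
rewrite !(mulmxDl, mulmxDr, mul1mx, mulmx1, =^~scalemxAl, =^~scalemxAr).
rewrite -N2E N3 N3' N4.
by apply/matrixP => i j; rewrite !mxE; ring.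
Qed.

Lemma rotmx0 n : rotmx 0 n = 1%:M.
Proof. by rewrite /rotmx sin0 cos0 subrr !scale0r !addr0. Qed.

Lemma rotmxNn a n : rotmx (- a) (- n) = rotmx a n.
Proof.
rewrite /rotmx -[- n]scaleN1r hatZ scaleN1r sinN cosN.
by rewrite scaleNr scalerN opprK mulmxN mulNmx opprK.
Qed.

Lemma rotmx_trmx a n : (rotmx a n)^T = rotmx (- a) n.
Proof.
rewrite /rotmx sinN cosN !linearD /= trmx1 !linearZ /= trmx_mul hat_so3.
by rewrite scaleNr scalerN mulmxN mulNmx opprK.
Qed.

(** The determinant is a square, as a rotation is the square of the rotation by
    half the angle. *)
Lemma rotmx_SO3 a n : dot3 n n = 1 -> SO3 (rotmx a n).
Proof.
move=> n1; have orth b : rotmx b n *m (rotmx b n)^T = 1%:M.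
  by rewrite rotmx_trmx rotmxD// subrr rotmx0.
split => //; rewrite [a]splitr -rotmxD// det_mulmx.
by have := congr1 determinant (orth (a / 2)); rewrite det_mulmx det_tr det1.
Qed.

Lemma hat_exp n k : dot3 n n = 1 ->
  hat n ^+ k.*2.+1 = (-1) ^+ k *: hat n /\
  hat n ^+ k.*2.+2 = (-1) ^+ k *: (hat n *m hat n).
Proof.
move=> n1; suff H : hat n ^+ k.*2.+1 = (-1) ^+ k *: hat n.
  by split=> //; rewrite exprS H -scalerAr.
elim: k => [|k IH]; first by rewrite expr1 scale1r.
rewrite doubleS !(exprS _ _.+1) IH -!scalerAr.
rewrite -[hat n * (hat n * hat n)]/(hat n *m (hat n *m hat n)) hat_cube//.
by rewrite exprS mulN1r scaleNr scalerN.
Qed.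

(** The powers of [hat n] are periodic up to sign, so the exponential series splits
    into the sine series along [hat n] and the cosine series along its square. *)
Lemma exp_term th n k : dot3 n n = 1 ->
  k.+1`!%:R^-1 *: (th *: hat n) ^+ k.+1 =
  sin_coeff th k.+1 *: hat n - cos_coeff th k.+1 *: (hat n *m hat n).
Proof.
move=> n1; rewrite exprZn scalerA -(odd_double_half k).
have [H1 H2] := hat_exp k./2 n1; case: (odd k); rewrite ?add1n ?add0n.
- rewrite -doubleS sin_coeff_even scale0r sub0r doubleS H2 scalerA -doubleS.
  rewrite -cos_coeff'E /cos_coeff' -scaleNr; congr (_ *: _).
  by rewrite -exprnP exprS; ring.
- rewrite cos_coeff_odd scale0r subr0 H1 scalerA -sin_coeff'E /sin_coeff'.
  by congr (_ *: _); rewrite -exprnP; ring.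
Qed.

Lemma exp_partial_sum th n k : dot3 n n = 1 ->
  \sum_(i < k.+1) i`!%:R^-1 *: (th *: hat n) ^+ i =
  1%:M + series (sin_coeff th) k.+1 *: hat n
    + (1 - series (cos_coeff th) k.+1) *: (hat n *m hat n).
Proof.
move=> n1; elim: k => [|k IH].
  rewrite big_ord_recl big_ord0 addr0 expr0 fact0 invr1 scale1r.
  rewrite /series /= !big_nat1 /sin_coeff /cos_coeff /= !mul0r mul1r expr0.
  by rewrite fact0 expr0z mul1r divr1 subrr !scale0r !addr0.
rewrite big_ord_recr /= IH exp_term// ![series _ k.+2]seriesSr.
apply/matrixP => i j; rewrite !mxE; ring.
Qed.

Lemma expm_hat th n : dot3 n n = 1 -> expm (th *: hat n) = rotmx th n.
Proof.
move=> n1; apply/cvg_lim => //.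
rewrite -cvg_shiftS /=.
under eq_fun do rewrite exp_partial_sum//.
have cs : series (sin_coeff th) k.+1 @[k --> \oo] --> sin th.
  rewrite (cvg_shiftS (series (sin_coeff th))) unlock.
  exact: is_cvg_series_sin_coeff.
have cc : series (cos_coeff th) k.+1 @[k --> \oo] --> cos th.
  rewrite (cvg_shiftS (series (cos_coeff th))) unlock.
  exact: is_cvg_series_cos_coeff.
apply: cvgD; last first.
  by apply: cvgZr_tmp; apply: cvgB => //; exact: cvg_cst.
apply: cvgD; first exact: cvg_cst.
exact: cvgZr_tmp.
Qed.

Lemma rotmxD2pi a k n : rotmx (a + 2 * k%:R * pi) n = rotmx a n.
Proof.
have -> : a + 2 * k%:R * pi = a + (pi *+ 2) *+ k :> R.
  by rewrite -[pi *+ 2]mulr_natl -mulr_natl; ring.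
by rewrite /rotmx (periodicn (@sinD2pi R)) (periodicn (@cosD2pi R)).
Qed.

(** The two descriptions of a rotation, which the map [q] chooses between. *)
Lemma rotmx2piN a n : rotmx (2 * pi - a) (- n) = rotmx a n.
Proof. by rewrite -[2 * pi - a]opprK rotmxNn -(rotmxD2pi _ 1); congr rotmx; ring. Qed.

Lemma rotmx2pi k n : rotmx (2 * k%:R * pi) n = 1%:M.
Proof. by rewrite -[X in rotmx X]add0r rotmxD2pi rotmx0. Qed.

Lemma expm_so3 X : so3 X ->
  exists2 n, dot3 n n = 1 & expm X = rotmx (snorm X) n /\ X = snorm X *: hat n.
Proof.
move=> sX; have [X0|X0] := pselect (X = 0); last first.
  have [_ n1 XE] := so3_polar sX X0; exists ((snorm X)^-1 *: vec X) => //.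
  by split => //; rewrite {1}XE expm_hat.
exists (delta_mx 0 0); first by rewrite dot3E !mxE /=; ring.
rewrite X0 snorm0 scale0r; split => //.
by rewrite -(scale0r (hat (delta_mx 0 0))) expm_hat// dot3E !mxE /=; ring.
Qed.

Lemma expm_SO3 X : so3 X -> SO3 (expm X).
Proof. by move=> /expm_so3[n n1 [-> _]]; exact: rotmx_SO3. Qed.

(** The two hemispheres are exchanged by the antipodal map, including on the
    equator, where the north hemisphere is a half-open half circle. *)
Lemma northN n : dot3 n n = 1 -> north (- n) <-> ~ north n.
Proof.
rewrite dot3E /north !mxE; move: (n 0 0) (n 1 0) (n 2 0) => x y z n1; split.
- move=> [z0|[z0 /andP[x1 x2] /andP[y0 y1]]] [z0'|[z0' /andP[x1' x2'] /andP[y0' y1']]];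
    try lra.
  have y00 : y = 0 by lra.
  have z00 : z = 0 by lra.
  have : (x - 1) * (x + 1) = 0 by move: n1; rewrite y00 z00; lra.
  by move=> /eqP; rewrite mulf_eq0 => /orP[/eqP|/eqP]; lra.
- move=> nn; have [z0|z0|z0] := ltgtP z 0.
  + by left; lra.
  + by exfalso; apply: nn; left; lra.
  + right; move: nn; rewrite z0 => nn; move: n1; rewrite z0 => n1.
    have x1 : -1 <= x <= 1 by apply/andP; split; nra.
    have y1 : -1 <= y <= 1 by apply/andP; split; nra.
    have [y0|y0|y0] := ltgtP y 0.
    * by split; [lra| |lra]; nra.
    * by exfalso; apply: nn; right; split => //; nra.
    * move: n1; rewrite y0 => n1.
      have : (x - 1) * (x + 1) = 0 by lra.
      move=> /eqP; rewrite mulf_eq0 => /orP[/eqP|/eqP] xE.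
        by split; lra.
      by exfalso; apply: nn; right; split => //; lra.
Qed.

(** The properties of [q(D)] that are used: the norm is below [2 pi], since the
    jump of [q] maps the norm [a <= pi] to [2 pi - a], and the direction is in the
    hemisphere of [X0], since the jump reverses it when it is not. *)
Lemma qDP (X0 Z : 'M[R]_3) : qD X0 Z ->
  [/\ so3 Z, snorm Z < 2 * pi & Z <> 0 -> same_hemisphere Z X0].
Proof.
have pi0 := @pi_gt0 R.
move=> [Y [sY Ypi] <-]; rewrite /qmap; case: asboolP => [[->|YX]|/not_orP[Y0 YX]].
- by split; rewrite /so3 ?snorm0 ?trmx0 ?oppr0//; lra.
- by split => //; lra.
have [Yp n1 _] := so3_polar sY Y0; split.
- exact: so3Z.
- rewrite snormZ ler0_norm; last by rewrite subr_le0 ler_pdivlMr//; lra.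
  by rewrite mulNr mulrBl divfK ?gt_eqF//; lra.
- move=> _; set c := 1 - _; have c0 : c < 0.
    by rewrite subr_lt0 ltr_pdivlMr//; lra.
  rewrite /same_hemisphere snormZ vecZ ltr0_norm// scalerA.
  have -> : (- c * snorm Y)^-1 * c = - (snorm Y)^-1.
    by rewrite invfM invrN mulrAC mulNr mulVf ?mulN1r// lt_eqF.
  rewrite scaleNr; have := northN n1.
  move: YX; rewrite /same_hemisphere.
  have := EM (north ((snorm Y)^-1 *: vec Y)).
  have := EM (north ((snorm X0)^-1 *: vec X0)); tauto.
Qed.

(** The axis of the rotation [A], oriented by [n0]: for [A = rotmx a m] the vector
    [u] is [2 (1 - cos a) (n0 . m) m] and [3 - tr A] is [2 (1 - cos a)]. *)
Definition axis (n0 : 'cV[R]_3) A : 'cV[R]_3 :=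
  let u := (A + A^T - (\tr A - 1)%:M) *m n0 in
  (Num.sqrt (dot3 n0 u * (3 - \tr A)))^-1 *: u.

(** [pi / 2 - a / 2] is the arctangent of [cot (a / 2) = sin a / (1 - cos a)]; in
    this form the angle is smooth on all of the interval from [0] to [2 pi],
    including [pi]. *)
Definition angle (n0 : 'cV[R]_3) A : R :=
  pi - 2 * atan (dot3 (vec (A - A^T)) (axis n0 A) / (3 - \tr A)).

Lemma cos_lt1_2pi (a : R) : 0 < a < 2 * pi -> cos a < 1.
Proof.
move=> a2; have -> : a = (a / 2) *+ 2 by rewrite -mulr_natl; lra.
have s0 : 0 < sin (a / 2) by apply: sin_gt0_pi; lra.
rewrite cos_mulr2n; have := cos2Dsin2 (a / 2).
by have : 0 < sin (a / 2) ^+ 2 by [rewrite exprn_gt0]; lra.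
Qed.

Lemma rotmx_sym a n : dot3 n n = 1 ->
  rotmx a n + (rotmx a n)^T - (\tr (rotmx a n) - 1)%:M =
  (2 * (1 - cos a)) *: (n *m n^T).
Proof.
move=> n1; rewrite rotmx_tr// rotmxE// !mx3E [RHS]mx3P !mxE !big_ord1 !mxE.
by apply: mx3_congr; split; ring.
Qed.

Lemma rotmx_skew a n : vec (rotmx a n - (rotmx a n)^T) = (2 * sin a) *: n.
Proof.
rewrite rotmx_trmx /rotmx sinN cosN scaleNr.
have -> : forall P Q S : 'M[R]_3, P + Q + S - (P - Q + S) = 2 *: Q.
  by move=> P Q S; apply/matrixP => i j; rewrite !mxE; ring.
by rewrite scalerA vecZ hatK.
Qed.

Lemma axis_rot a m n0 : dot3 m m = 1 -> cos a < 1 -> 0 < dot3 n0 m ->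
  axis n0 (rotmx a m) = m.
Proof.
move=> m1 ca d0; rewrite /axis rotmx_sym// rotmx_tr//.
have -> : (2 * (1 - cos a)) *: (m *m m^T) *m n0 = (2 * (1 - cos a) * dot3 n0 m) *: m.
  rewrite -scalemxAl -mulmxA -[RHS]scalerA; congr (_ *: _).
  apply/matrixP => i j; rewrite !mxE big_ord1 !mxE sum_I3 !mxE dot3E !ord1. ring.
rewrite dot3Zr scalerA.
have -> : 2 * (1 - cos a) * dot3 n0 m * dot3 n0 m * (3 - (1 + 2 * cos a)) =
  (2 * (1 - cos a) * dot3 n0 m) ^+ 2 by ring.
rewrite sqrtr_sqr gtr0_norm; last by rewrite !mulr_gt0//; lra.
by rewrite mulVf ?scale1r// gt_eqF// !mulr_gt0//; lra.
Qed.

Lemma angle_rot (a : R) m n0 : dot3 m m = 1 -> 0 < a < 2 * pi -> 0 < dot3 n0 m ->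
  angle n0 (rotmx a m) = a.
Proof.
move=> m1 a2 d0; have ca := cos_lt1_2pi a2.
rewrite /angle axis_rot// rotmx_skew rotmx_tr// dot3Zl m1 mulr1.
have h0 : 0 < sin (a / 2) by apply: sin_gt0_pi; lra.
have -> : 2 * sin a / (3 - (1 + 2 * cos a)) = tan (pi / 2 - a / 2).
  have {1 2}-> : a = (a / 2) *+ 2 by rewrite -mulr_natl; lra.
  rewrite sin_mulr2n cos_mulr2n /tan sinB cosB sin_pihalf cos_pihalf.
  have -> : cos (a / 2) ^+ 2 = 1 - sin (a / 2) ^+ 2 by exact: cos2sin2.
  have s0 : sin (a / 2) != 0 by rewrite gt_eqF.
  rewrite !mul0r !mul1r subr0 add0r.
  have -> : 3 - (1 + 2 * ((1 - sin (a / 2) ^+ 2) *+ 2 - 1)) = 4 * sin (a / 2) ^+ 2 by ring.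
  by field.
by rewrite tanK; [lra|rewrite in_itv /=; lra].
Qed.

(** If the orientation by [n0] is opposite to [m], then [axis] and [angle] see the
    same rotation as [rotmx (2 pi - a) (- m)]. *)
Lemma axis_angle_rot (a : R) m n0 : dot3 m m = 1 -> 0 < a < 2 * pi -> dot3 n0 m != 0 ->
  (axis n0 (rotmx a m) = m /\ angle n0 (rotmx a m) = a) \/
  (axis n0 (rotmx a m) = - m /\ angle n0 (rotmx a m) = 2 * pi - a).
Proof.
move=> m1 a2 d0; have [d|d|d] := ltgtP 0 (dot3 n0 m).
- by left; rewrite axis_rot ?angle_rot// cos_lt1_2pi.
- have m1' : dot3 (- m) (- m) = 1 by rewrite -scaleN1r dot3Zl dot3Zr m1; ring.
  have d' : 0 < dot3 n0 (- m) by rewrite -scaleN1r dot3Zr; lra.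
  have a2' : 0 < 2 * pi - a < 2 * pi by lra.
  by right; rewrite -(rotmx2piN a m) axis_rot ?angle_rot// cos_lt1_2pi.
- by move: d0; rewrite -d eqxx.
Qed.

(** The angle between [0] and [pi], from [tan (a / 2) ^ 2 = (1 - cos a) / (1 + cos a)];
    unlike [angle] it is continuous at the identity. *)
Definition small_angle A : R := 2 * atan (Num.sqrt ((3 - \tr A) / (1 + \tr A))).

Lemma small_angle_rot (a : R) n : dot3 n n = 1 -> 0 <= a < 2 * pi -> -1 < \tr (rotmx a n) ->
  (a < pi /\ small_angle (rotmx a n) = a) \/
  (pi < a /\ small_angle (rotmx a n) = 2 * pi - a).
Proof.
move=> n1; wlog: a n n1 / a <= pi => [H a2 tr|ap a2].
  have /orP[ap|ap] : (a <= pi) || (pi < a) by rewrite leNgt orNb.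
    exact: H.
  have n1' : dot3 (- n) (- n) = 1 by rewrite -scaleN1r dot3Zl dot3Zr n1; ring.
  have := H (2 * pi - a) (- n) n1'; rewrite rotmx2piN.
  by move=> []; [lra|lra|by []|move=> [_ ->]; right; lra|lra].
rewrite /small_angle rotmx_tr// => tr; left.
have api : a < pi.
  rewrite lt_neqAle ap andbT; apply/eqP => aE.
  by move: tr; rewrite aE cospi; lra.
split => //.
have c0 : 0 < cos (a / 2) by apply: cos_gt0_pihalf; lra.
have s0 : 0 <= sin (a / 2) by apply: sin_ge0_pi; lra.
have -> : (3 - (1 + 2 * cos a)) / (1 + (1 + 2 * cos a)) = tan (a / 2) ^+ 2.
  have {1 2}-> : a = (a / 2) *+ 2 by rewrite -mulr_natl; lra.
  rewrite cos_mulr2n /tan expr_div_n sin2cos2.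
  have cn : cos (a / 2) != 0 by rewrite gt_eqF.
  have -> : 1 + (1 + 2 * (cos (a / 2) ^+ 2 *+ 2 - 1)) = 4 * cos (a / 2) ^+ 2 by ring.
  by field.
rewrite sqrtr_sqr ger0_norm; last by rewrite divr_ge0// ltW.
by rewrite tanK; [lra|rewrite in_itv /=; lra].
Qed.

End Rotations3.

(** * Smoothness of the axis and of the angle *)

Section SmoothLog.
Context {R : realType}.
Implicit Types (V : normedModType R) (n : 'cV[R]_3) (A : 'M[R]_3).

(** The square of the factor [2 (1 - cos a) (n0 . m)] in the definition of [axis]
    ([axis_den_rot]); axis and angle are smooth where it is positive. *)
Definition axis_den n A : R :=
  dot3 n ((A + A^T - (\tr A - 1)%:M) *m n) * (3 - \tr A).

Lemma Ck_at_trace k V (x : V) (f : V -> 'M[R]_3) :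
  Ck_at k x f -> Ck_at k x (fun y => \tr (f y)).
Proof. by move=> cf; apply: Ck_at_sum => i; exact: Ck_at_coord. Qed.

Lemma Ck_at_axis_num k V (x : V) (f : V -> 'M[R]_3) n i : Ck_at k x f ->
  Ck_at k x (fun y => ((f y + (f y)^T - (\tr (f y) - 1)%:M) *m n) i 0).
Proof.
move=> cf; under eq_fun do rewrite mxE.
apply: Ck_at_sum => j; apply: Ck_atM; last exact: Ck_at_cst.
under eq_fun do rewrite !mxE.
apply: Ck_atB; first by apply: Ck_atD; exact: Ck_at_coord.
under eq_fun do rewrite -mulr_natr.
apply: Ck_atM; last exact: Ck_at_cst.
by apply: Ck_atB; [exact: Ck_at_trace|exact: Ck_at_cst].
Qed.

Lemma Ck_at_axis_den k V (x : V) (f : V -> 'M[R]_3) n : Ck_at k x f ->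
  Ck_at k x (fun y => axis_den n (f y)).
Proof.
move=> cf; apply: Ck_atM.
  apply: Ck_at_sum => i; apply: Ck_atM; first exact: Ck_at_cst.
  exact: Ck_at_axis_num.
by apply: Ck_atB; [exact: Ck_at_cst|exact: Ck_at_trace].
Qed.

Lemma Ck_at_axis k V (x : V) (f : V -> 'M[R]_3) n i : 0 < axis_den n (f x) ->
  Ck_at k x f -> Ck_at k x (fun y => axis n (f y) i 0).
Proof.
move=> fx cf; rewrite /axis; under eq_fun do rewrite mxE.
apply: Ck_atM; last exact: Ck_at_axis_num.
apply: Ck_atV; first by rewrite gt_eqF// sqrtr_gt0.
by apply: Ck_at_sqrt => //; exact: Ck_at_axis_den.
Qed.

Lemma Ck_at_angle k V (x : V) (f : V -> 'M[R]_3) n : 0 < axis_den n (f x) ->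
  Ck_at k x f -> Ck_at k x (fun y => angle n (f y)).
Proof.
move=> fx cf; rewrite /angle.
apply: Ck_atB; first exact: Ck_at_cst.
apply: Ck_atM; first exact: Ck_at_cst.
apply: Ck_at_atan; apply: Ck_atM.
  apply: Ck_at_sum => i; apply: Ck_atM; last exact: Ck_at_axis.
  under eq_fun do rewrite !mxE.
  by apply: Ck_atB; exact: Ck_at_coord.
apply: Ck_atV; last by apply: Ck_atB; [exact: Ck_at_cst|exact: Ck_at_trace].
by apply/eqP => E; move: fx; rewrite /axis_den E mulr0 ltxx.
Qed.

Lemma hat_sum n : hat n = \sum_i n i 0 *: hat (delta_mx i 0).
Proof.
rewrite sum_I3 !hatE !mx3E !mxE /=.
by apply: mx3_congr; split; ring.
Qed.

Lemma Ck_at_hat k V (x : V) (f : V -> 'cV[R]_3) :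
  (forall i, Ck_at k x (fun y => f y i 0)) -> Ck_at k x (fun y => hat (f y)).
Proof.
move=> cf; under eq_fun do rewrite hat_sum.
by apply: Ck_at_sum => i; exact: Ck_atZl.
Qed.

Lemma axis_den_rot n a m : dot3 m m = 1 ->
  axis_den n (rotmx a m) = (2 * (1 - cos a) * dot3 n m) ^+ 2.
Proof.
move=> m1; rewrite /axis_den rotmx_sym// rotmx_tr//.
have -> : (2 * (1 - cos a)) *: (m *m m^T) *m n = (2 * (1 - cos a) * dot3 n m) *: m.
  rewrite -scalemxAl -mulmxA -[RHS]scalerA; congr (_ *: _).
  by apply/matrixP => i j; rewrite !mxE big_ord1 !mxE sum_I3 !mxE dot3E !ord1; ring.
by rewrite dot3Zr; ring.
Qed.

(** A rotation with positive [axis_den] is not the identity, and its axis is not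
    orthogonal to [n]. *)
Lemma axis_angle_den a m n : dot3 m m = 1 -> 0 <= a < 2 * pi ->
  0 < axis_den n (rotmx a m) -> 0 < a /\
  ((axis n (rotmx a m) = m /\ angle n (rotmx a m) = a) \/
   (axis n (rotmx a m) = - m /\ angle n (rotmx a m) = 2 * pi - a)).
Proof.
move=> m1 /andP[a0 a2]; rewrite axis_den_rot// => den0.
have den : 2 * (1 - cos a) * dot3 n m != 0.
  by apply/eqP => E; move: den0; rewrite E expr0n ltxx.
have a_gt0 : 0 < a.
  rewrite lt_def a0 andbT; apply/eqP => aE.
  by move: den; rewrite aE cos0 subrr mulr0 mul0r eqxx.
split => //; apply: axis_angle_rot => //; first by rewrite a_gt0.
by apply/eqP => E; move: den; rewrite E mulr0 eqxx.
Qed.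

(** A function that is CS is the restriction of one function of [eps] that is of
    class C^k near every point, [0] included. *)
Lemma CS_ext k (W : normedModType R) (l0 : R) (f : R -> W) : CS k l0 f ->
  exists g : R -> W, forall e : R, 0 <= e < Num.sqrt l0 ->
    Ck_at k e g /\ f (e ^+ 2) = g e.
Proof.
move=> [A [g [oA SA CA fg]]]; exists g => e he; split; last exact: fg.
by exists A; split => //; exact: SA.
Qed.

Lemma CSt_ext k (W : normedModType R) (l0 : R) (f : R -> R -> W) : CSt k l0 f ->
  exists g : R * R -> W, forall t e : R, 0 <= t -> 0 <= e < Num.sqrt l0 ->
    Ck_at k (t, e) g /\ f t (e ^+ 2) = g (t, e).
Proof.
move=> [A [g [oA SA CA fg]]]; exists g => t e t0 he; split; last first.
  by apply: (fg (t, e)).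
by exists A; split => //; exact: (SA (t, e)).
Qed.

(** From a neighbourhood of [eps = 0] to a range [lambda < l1]. *)
Lemma near0_sqrt (l0 : R) (P : R -> Prop) : 0 < l0 -> (\forall e \near 0, P e) ->
  exists2 l1, 0 < l1 <= l0 & forall e, 0 <= e < Num.sqrt l1 -> P e.
Proof.
move=> l00 /nbhs_ballP[d /= d0 dP].
exists (Num.min l0 (d ^+ 2)).
  by rewrite lt_min l00 exprn_gt0//= ge_min lexx.
move=> e /andP[e0 ed]; apply: dP; rewrite /ball /= sub0r normrN ger0_norm//.
rewrite (lt_le_trans ed)// -[leRHS]ger0_norm ?(ltW d0)// -sqrtr_sqr.
by rewrite ler_wsqrtr// ge_min lexx orbT.
Qed.

Lemma sqrt_lt_sqrt (l l1 : R) : 0 <= l < l1 -> 0 <= Num.sqrt l < Num.sqrt l1.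
Proof.
move=> /andP[l0 ll]; rewrite sqrtr_ge0 ltr_sqrt//; exact: le_lt_trans ll.
Qed.

Lemma sqrt_lt_sub (e l1 l2 : R) : l1 <= l2 -> 0 <= e < Num.sqrt l1 ->
  0 <= e < Num.sqrt l2.
Proof.
by move=> ll /andP[-> /lt_le_trans]; apply; rewrite ler_wsqrtr.
Qed.

Lemma Ck_at_CS k (W : normedModType R) (l0 : R) (f g : R -> W) :
  0 < l0 -> Ck_at k 0 g -> exists2 l1, 0 < l1 <= l0 & forall l2, l2 <= l1 ->
   (forall e, 0 <= e < Num.sqrt l2 -> f (e ^+ 2) = g e) -> CS k l2 f.
Proof.
move=> l00 [A [oA A0 CA]].
have [l1 l10 AP] := near0_sqrt l00 (open_nbhs_nbhs (conj oA A0)).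
exists l1 => // l2 l21 fg; exists A, g; split => // e /= he.
by apply: AP; exact: sqrt_lt_sub he.
Qed.

Lemma atan_le (x : R) : 0 <= x -> 0 <= atan x <= x.
Proof.
move=> x0; rewrite -{1}(@atan0 R) le_atan//=.
move: x0; rewrite le_eqVlt => /orP[/eqP <-|x0]; first by rewrite atan0.
have [|c _] := @MVT _ (@atan R) (fun x => (1 + x ^+ 2)^-1) 0 x x0.
  by apply: continuous_subspaceT => y; exact: continuous_atan.
rewrite atan0 !subr0 => ->; rewrite ler_piMl ?(ltW x0)// invf_le1.
  by rewrite ler_wpDr// sqr_ge0.
by rewrite ltr_pwDl// sqr_ge0.
Qed.

Lemma vec_bound (M : 'M[R]_3) n : `|dot3 (vec M) n| <= (\sum_i `|n i 0|) * `|M|.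
Proof.
rewrite /dot3 (le_trans (ler_norm_sum _ _ _))// mulr_suml ler_sum// => i _.
rewrite normrM mulrC ler_wpM2l// mxE.
rewrite -[`|M|]/(mx_norm M) mx_normrE.
exact: (le_bigmax _ (fun ij : 'I_3 * 'I_3 => `|M ij.1 ij.2|) (i + 2, i + 1)).
Qed.

End SmoothLog.

(** * The branch of frequency matrices *)

Lemma hatD (R : realType) (u v : 'cV[R]_3) : hat (u + v) = hat u + hat v.
Proof. by rewrite !hatE mx3D !mxE; apply: mx3_congr; split; ring. Qed.

(** The rows form an orthogonal matrix, whose left inverse is also its right
    inverse. *)
Lemma orthonormal_decomp (R : realType) (u v t : 'cV[R]_3) :
  [/\ dot3 u u = 1, dot3 v v = 1 & dot3 t t = 1] ->
  [/\ dot3 u v = 0, dot3 u t = 0 & dot3 v t = 0] ->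
  forall x, x = dot3 x u *: u + dot3 x v *: v + dot3 x t *: t.
Proof.
rewrite !dot3E => -[uu vv tt] [uv ut vt] x.
pose O := mx3 (u 0 0) (u 1 0) (u 2 0) (v 0 0) (v 1 0) (v 2 0) (t 0 0) (t 1 0) (t 2 0).
have : O *m O^T = 1%:M.
  by rewrite !mx3E; apply: mx3_congr; split; lra.
move=> /mulmx1C OO; rewrite -[LHS]mul1mx -OO -mulmxA.
apply/matrixP => i j; rewrite !ord1 mxE sum_I3 ![(O *m x) _ _]mxE !sum_I3 !mxE !dot3E /=.
move: i; apply: forall_I3 => /=; ring.
Qed.

Lemma nonresonant_or_resonant (R : realType) (X0 : 'M[R]_3) (wbif : R) :
  so3 X0 -> X0 <> 0 -> nonresonant X0 wbif \/ resonant X0 wbif.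
Proof.
move=> sX0 X0n; have [nres|] := pselect (nonresonant X0 wbif); first by left.
move=> /existsNP[n /contrapT nE]; right; exists n => // n0.
have [+ _ _] := so3_polar sX0 X0n.
by rewrite nE n0 mul0r ltxx.
Qed.

Lemma north_gt0 (R : realType) (v : 'cV[R]_3) : 0 < v 2 0 -> north v.
Proof. by left. Qed.

Lemma north_lt0 (R : realType) (v : 'cV[R]_3) : v 2 0 < 0 -> ~ north v.
Proof. by move=> v0 [|[v20 _ _]]; [rewrite lt_gtF|move: v0; rewrite v20 ltxx]. Qed.

Section Branch.
Context {R : realType} (m : nat) (X0 : 'M[R]_3) (wbif l0 : R) (w : R -> R)
  (Z : R -> R -> 'M[R]_3) (k : nat) (al0 : R).
Hypothesis sX0 : so3 X0.
Hypothesis X0n : X0 <> 0.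
Hypothesis l0_gt0 : 0 < l0.
Hypothesis wbif_neq0 : wbif <> 0.
Hypothesis w_CS : CS m l0 w.
Hypothesis w0 : w 0 = wbif.
Hypothesis Z_qD : forall t l, 0 <= t -> 0 <= l < l0 -> qD X0 (Z t l).
Hypothesis Z_CS : CSt_qD m l0 Z.
Hypothesis Z0 : expm (Z (2 * pi / `|wbif|) 0) = expm ((2 * pi / `|wbif|) *: X0).
Hypothesis al0_itv : 0 <= al0 < 2 * pi.
Hypothesis al0_k : 2 * pi * snorm X0 / `|wbif| = al0 + 2 * k%:R * pi.

Let T l := 2 * pi / `|w l|.
Let n0 := (snorm X0)^-1 *: vec X0.
Let pi0 : 0 < pi :> R. Proof. exact: pi_gt0. Qed.

Let pin : pi != 0 :> R. Proof. by rewrite gt_eqF. Qed.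

Let X0_polar : [/\ 0 < snorm X0, dot3 n0 n0 = 1 & X0 = snorm X0 *: hat n0].
Proof. exact: so3_polar. Qed.

Let wbif_gt0 : 0 < `|wbif|. Proof. by rewrite normr_gt0; apply/eqP. Qed.

(** The definition of [k] and [al0], solved for the norm of [X0]. *)
Lemma snormX0E : snorm X0 = (al0 + 2 * k%:R * pi) * `|wbif| / (2 * pi).
Proof.
have wn : `|wbif| != 0 by rewrite gt_eqF.
rewrite -al0_k; move: (@pi R) pin => p pn.
by field; rewrite wn pn.
Qed.

(** The functions [|omega|] and [exp (Z T)] of [eps], extended to be smooth at
    [eps = 0].  The absolute value is smooth as the square root of a square that
    does not vanish. *)
Lemma monodromy_ext : exists l1 (h : R -> R) (g : R -> 'M[R]_3),
  0 < l1 <= l0 /\ forall e, 0 <= e < Num.sqrt l1 ->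
    [/\ Ck_at m e h, 0 < h e, h e = `|w (e ^+ 2)|, Ck_at m e g
      & g e = expm (Z (T (e ^+ 2)) (e ^+ 2))].
Proof.
have [f fE] := CS_ext w_CS; have [G GE] := @CSt_ext _ _ _ _ (fun t l => expm (Z t l)) Z_CS.
have e0 : 0 <= (0 : R) < Num.sqrt l0 by rewrite lexx sqrtr_gt0.
have [f0C f0E] := fE 0 e0.
have f0 : 0 < f 0 * f 0.
  by rewrite -f0E expr0n /= w0 -expr2 lt_def sqr_ge0 andbT sqrf_eq0; apply/eqP.
have ffC : Ck_at m 0 (fun e => f e * f e) by exact: Ck_atM.
have [l1 l10 fP] := near0_sqrt l0_gt0
  (cvgr_gt _ (Ck_at_cont ffC : (fun e => f e * f e) @ 0 --> f 0 * f 0) _ f0).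
exists l1, (fun e => Num.sqrt (f e * f e)),
  (fun e => G (2 * pi / Num.sqrt (f e * f e), e)); split => // e he.
have he0 : 0 <= e < Num.sqrt l0.
  by case/andP: l10 => _ ll; exact: sqrt_lt_sub he.
have [fC fe] := fE e he0; have ff0 := fP e he.
have hC : Ck_at m e (fun e => Num.sqrt (f e * f e)).
  by apply: Ck_at_sqrt => //; exact: Ck_atM.
have h_gt0 : 0 < Num.sqrt (f e * f e) by rewrite sqrtr_gt0.
have hE : Num.sqrt (f e * f e) = `|w (e ^+ 2)| by rewrite fe -expr2 sqrtr_sqr.
have T0 : 0 <= 2 * pi / Num.sqrt (f e * f e) by rewrite divr_ge0 ?mulr_ge0 ?ltW.
have [GC GEe] := GE _ e T0 he0.
split => //; last by rewrite -GEe hE.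
apply: (@Ck_at_comp _ _ _ _ _ e (fun e => (2 * pi / Num.sqrt (f e * f e), e)) G) => //.
apply: Ck_at_pair; last exact: Ck_at_id.
apply: Ck_atM; first exact: Ck_at_cst.
by apply: Ck_atV => //; rewrite gt_eqF.
Qed.

Context (l1 : R) (h : R -> R) (g : R -> 'M[R]_3).
Hypothesis l1_itv : 0 < l1 <= l0.
Hypothesis hg : forall e, 0 <= e < Num.sqrt l1 ->
    [/\ Ck_at m e h, 0 < h e, h e = `|w (e ^+ 2)|, Ck_at m e g
      & g e = expm (Z (T (e ^+ 2)) (e ^+ 2))].

Let e0_itv : 0 <= (0 : R) < Num.sqrt l1.
Proof. by rewrite lexx sqrtr_gt0; case/andP: l1_itv. Qed.

Let hg0 : [/\ Ck_at m 0 h, 0 < h 0, h 0 = `|wbif|, Ck_at m 0 g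
      & g 0 = rotmx al0 n0].
Proof.
have [X0p n01 X0E] := X0_polar.
have [hC h0 hE gC gE] := hg e0_itv; split => //; first by rewrite hE expr0n /= w0.
rewrite gE expr0n /= /T w0 Z0 X0E scalerA.
have -> : 2 * pi / `|wbif| * snorm X0 = al0 + 2 * k%:R * pi by rewrite -al0_k; ring.
by rewrite expm_hat// rotmxD2pi.
Qed.

(** The angle [a] and the axis [n] of the rotation vector [Z T] in [q(D)]; for
    [a = 0] the axis is arbitrary, so nothing is said about its hemisphere. *)
Lemma monodromy_polar l : 0 <= l < l1 -> exists a n,
  [/\ dot3 n n = 1, 0 <= a < 2 * pi, Z (T l) l = a *: hat n, g (Num.sqrt l) = rotmx a n
    & 0 < a -> (north n <-> north n0)].
Proof.
move=> hl; have [ll0 ll1] := andP hl.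
have [_ h0 hE _ gE] := hg (sqrt_lt_sqrt hl).
rewrite sqr_sqrtr// in hE gE.
have T0 : 0 <= T l by rewrite /T -hE divr_ge0 ?mulr_ge0 ?ltW.
have hl0 : 0 <= l < l0.
  by rewrite ll0 (lt_le_trans ll1)//; case/andP: l1_itv.
have [sZ Z2 ZX] := qDP (Z_qD T0 hl0).
have [n n1 [Ze ZE]] := expm_so3 sZ.
exists (snorm (Z (T l) l)), n; split => //.
- by rewrite snorm_ge0.
- by rewrite gE.
- move=> Zp; have Zn : Z (T l) l <> 0 by move=> E; move: Zp; rewrite E snorm0 ltxx.
  have := ZX Zn; rewrite /same_hemisphere.
  suff -> : (snorm (Z (T l) l))^-1 *: vec (Z (T l) l) = n by [].
  by rewrite {2}ZE vecZ hatK scalerA mulVf ?scale1r// gt_eqF.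
Qed.

(** Lifting adds [2 pi k] to the angle. *)
Lemma lifted_polar l a n : dot3 n n = 1 -> 0 < a -> 0 < `|w l| ->
  Z (T l) l = a *: hat n ->
  lifted k (w l) (Xperiod w Z l) = ((a + 2 * k%:R * pi) * `|w l| / (2 * pi)) *: hat n.
Proof.
move=> n1 a0 wl ZE.
have XE : Xperiod w Z l = (`|w l| / (2 * pi) * a) *: hat n.
  by rewrite /Xperiod -/(T l) ZE scalerA.
rewrite /lifted XE snormZ snorm_hat// mulr1 scalerA; congr (_ *: _).
rewrite gtr0_norm; last by rewrite !mulr_gt0// ?invr_gt0 ?mulr_gt0.
have wn : `|w l| != 0 by rewrite gt_eqF.
have an : a != 0 by rewrite gt_eqF.
by move: (@pi R) pin => p pn; field; rewrite ?wn ?an ?pn.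
Qed.

(** In polar form, gluing replaces the angle [a] and the axis [n] by [2 pi - a] and
    [- n] before the [k] full turns are added. *)
Lemma glued_polar (W a : R) n : dot3 n n = 1 -> 0 < a -> 0 < `|W| ->
  let X := ((a + 2 * k%:R * pi) * `|W| / (2 * pi)) *: hat n in
  glued k W X (((2 * pi - a + 2 * k%:R * pi) * `|W| / (2 * pi)) *: hat (- n)).
Proof.
move=> n1 a0 W0 X; right.
have c0 : 0 < (a + 2 * k%:R * pi) * `|W| / (2 * pi).
  by rewrite divr_gt0 ?mulr_gt0// ltr_wpDr// !mulr_ge0// ltW.
have sX : snorm X = (a + 2 * k%:R * pi) * `|W| / (2 * pi).
  by rewrite snormZ snorm_hat// mulr1 gtr0_norm.
split; first by move=> E; move: sX c0; rewrite E snorm0 => <-; rewrite ltxx.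
rewrite sX /X scalerA -[- n]scaleN1r hatZ scalerA; congr (_ *: _).
have ak0 : a + 2 * k%:R * pi != 0 by rewrite gt_eqF// ltr_wpDr// !mulr_ge0// ltW.
have Wn : `|W| != 0 by rewrite gt_eqF.
rewrite natrD natrM; move: (@pi R) pin ak0 => p pn ak0.
by field; rewrite ak0 Wn pn.
Qed.

Let w_gt0 l : 0 <= l < l1 -> 0 < `|w l|.
Proof.
move=> hl; have [_ h0 hE _ _] := hg (sqrt_lt_sqrt hl).
by move: h0; rewrite hE sqr_sqrtr//; case/andP: hl.
Qed.

Let T_w l : 0 <= l < l1 -> T l * `|w l| = 2 * pi.
Proof. by move=> hl; rewrite /T divfK// gt_eqF// w_gt0. Qed.

Let expm0 : expm 0 = 1%:M :> 'M[R]_3.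
Proof.
have [n n1 [-> _]] := @expm_so3 R 0 (eq_trans (trmx0 _ _ _) (esym (oppr0 _))).
by rewrite snorm0 rotmx0.
Qed.

Lemma lifted_frequency l : 0 <= l < l1 ->
  so3 (lifted k (w l) (Xperiod w Z l)) /\
  expm (T l *: lifted k (w l) (Xperiod w Z l)) = expm (Z (T l) l).
Proof.
move=> hl; have [a [n [n1 /andP[a0 _] ZE _ _]]] := monodromy_polar hl.
have wl := w_gt0 hl.
move: a0; rewrite le_eqVlt => /orP[/eqP a0|a0].
  have Z00 : Z (T l) l = 0 by rewrite ZE -a0 scale0r.
  rewrite /lifted /Xperiod -/(T l) Z00 !scaler0 expm0; split => //.
  by rewrite /so3 trmx0 oppr0.
rewrite (lifted_polar n1 a0 wl ZE); split; first exact/so3Z/hat_so3.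
rewrite ZE scalerA !expm_hat//.
have -> : T l * ((a + 2 * k%:R * pi) * `|w l| / (2 * pi)) = a + 2 * k%:R * pi.
  rewrite mulrA mulrCA T_w// mulfK// mulf_neq0// pnatr_eq0//.
exact: rotmxD2pi.
Qed.

Let Xperiod_eq0 l : 0 <= l < l1 -> snorm (Xperiod w Z l) = 0 -> Z (T l) l = 0.
Proof.
move=> hl; have [a [n [n1 _ ZE _ _]]] := monodromy_polar hl.
have wl := w_gt0 hl.
have sX : so3 (Xperiod w Z l) by rewrite /Xperiod -/(T l) ZE; exact/so3Z/so3Z/hat_so3.
move=> /(snorm_eq0 sX)/eqP; rewrite scaler_eq0 => /orP[|/eqP//].
by rewrite gt_eqF// divr_gt0// mulr_gt0.
Qed.

(** If [Z T = 0], then [k] full turns around any axis give the identity. *)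
Lemma unit_frequency l Q : 0 <= l < l1 -> so3 Q -> snorm Q = 1 ->
  snorm (Xperiod w Z l) = 0 ->
  [/\ so3 (Xperiod w Z l + (k%:R * `|w l|) *: Q),
      snorm (Xperiod w Z l + (k%:R * `|w l|) *: Q) = k%:R * `|w l|
    & expm (T l *: (Xperiod w Z l + (k%:R * `|w l|) *: Q)) = expm (Z (T l) l)].
Proof.
move=> hl sQ Q1 /(Xperiod_eq0 hl) Z00.
rewrite /Xperiod -/(T l) Z00 scaler0 add0r expm0; split.
- exact: so3Z.
- by rewrite snormZ Q1 mulr1 ger0_norm// mulr_ge0.
- rewrite scalerA mulrCA T_w//.
  have [n n1 [_ ->]] := expm_so3 sQ; rewrite Q1 scale1r expm_hat//.
  by rewrite -(rotmx2pi k n); congr rotmx; ring.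
Qed.

(** The glued branch of [X^f] as a function of [eps]: the angle and the axis from
    the smooth formulas, with [k] full turns added, divided by the period. *)
Definition log_branch (e : R) : 'M[R]_3 :=
  ((angle n0 (g e) + 2 * k%:R * pi) * h e / (2 * pi)) *: hat (axis n0 (g e)).

Section Nonresonant.
Hypothesis nonres : nonresonant X0 wbif.
Context (Xf : R -> 'M[R]_3).
Hypothesis XfE : forall l, 0 <= l < l0 -> Xf l = lifted k (w l) (Xperiod w Z l).

(** If [al0] were [0], then [|X0|] would be [k |omega_bif|]. *)
Lemma nonresonant_al0 : 0 < al0.
Proof.
have /andP[a0 _] := al0_itv; rewrite lt_def a0 andbT; apply/eqP => E.
have := snormX0E; rewrite E add0r => sE.
have {}sE : snorm X0 = k%:R * `|wbif|.
  by rewrite sE; move: (@pi R) pin => p pn; field.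
have [wp|wp] := lerP 0 wbif.
  by apply: (nonres (n := k%:Z)); rewrite sE ger0_norm// -pmulrn.
apply: (nonres (n := - k%:Z)); rewrite sE ltr0_norm// mulrN.
by rewrite rmorphN /= mulNr -pmulrn.
Qed.

Let den0 : 0 < axis_den n0 (g 0).
Proof.
have [_ n01 _] := X0_polar; have [_ _ _ _ ->] := hg0.
rewrite axis_den_rot// n01 mulr1 exprn_gt0// mulr_gt0// subr_gt0.
by apply: cos_lt1_2pi; rewrite nonresonant_al0; case/andP: al0_itv.
Qed.

Let axis0 : axis n0 (g 0) = n0 /\ angle n0 (g 0) = al0.
Proof.
have [_ n01 _] := X0_polar; have [_ _ _ _ ->] := hg0.
have a0 : 0 < al0 < 2 * pi by rewrite nonresonant_al0; case/andP: al0_itv.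
by rewrite axis_rot ?angle_rot// ?n01// cos_lt1_2pi.
Qed.

Lemma log_branch0 : log_branch 0 = X0.
Proof.
have [_ _ X0E] := X0_polar; have [_ _ h0 _ _] := hg0.
by rewrite /log_branch axis0.1 axis0.2 h0 -snormX0E -X0E.
Qed.

Lemma log_branch_Ck e : 0 <= e < Num.sqrt l1 -> 0 < axis_den n0 (g e) ->
  Ck_at m e log_branch.
Proof.
move=> he den; have [hC _ _ gC _] := hg he.
rewrite /log_branch; under eq_fun do rewrite -hatZ.
apply: Ck_at_hat => i; under eq_fun do rewrite mxE.
apply: Ck_atM; last exact: Ck_at_axis.
apply: Ck_atM; last exact: Ck_at_cst.
apply: Ck_atM => //; apply: Ck_atD; last exact: Ck_at_cst.
exact: Ck_at_angle.
Qed.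

(** The axis from the formula is the axis [n] of [Z T] or [- n].  It is [n] if it is
    known to lie in the hemisphere of [n0], as [n] does: the antipodal case is then
    excluded. *)
Lemma log_branch_glued l : 0 <= l < l1 -> 0 < axis_den n0 (g (Num.sqrt l)) ->
  [/\ glued k (w l) (Xf l) (log_branch (Num.sqrt l)),
      0 < axis n0 (g (Num.sqrt l)) 2 0 * n0 2 0 \/ axis n0 (g (Num.sqrt l)) = n0 ->
        log_branch (Num.sqrt l) = Xf l
    & exists2 a, 0 < a < 2 * pi & snorm (Xf l) * T l = a + 2 * k%:R * pi].
Proof.
move=> hl den; have [_ n01 _] := X0_polar.
have [a [n [n1 a2 ZE gE nn0]]] := monodromy_polar hl.
have [_ _ hE _ _] := hg (sqrt_lt_sqrt hl).
have {}hE : h (Num.sqrt l) = `|w l| by rewrite hE sqr_sqrtr//; case/andP: hl.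
have wl := w_gt0 hl.
move: den; rewrite gE => /(axis_angle_den n1 a2)[a0 axa].
have {}a2 : 0 < a < 2 * pi by rewrite a0; case/andP: a2.
have ll0 : 0 <= l < l0.
  by case/andP: l1_itv => _; case/andP: hl => -> /lt_le_trans; apply.
have XE : Xf l = ((a + 2 * k%:R * pi) * `|w l| / (2 * pi)) *: hat n.
  by rewrite XfE// (lifted_polar n1 a0 wl ZE).
have c0 : 0 < (a + 2 * k%:R * pi) * `|w l| / (2 * pi).
  by rewrite divr_gt0 ?mulr_gt0// ltr_wpDr// !mulr_ge0// ltW.
rewrite /log_branch hE gE; split.
- case: axa => [[-> ->]|[-> ->]]; first by left.
  by rewrite XE; exact: glued_polar.
- case: axa => [[-> ->]//|[-> ->]] opp; exfalso.
  have := nn0 a0; case: opp => [opp|<-]; last by have := northN n1; tauto.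
  have {}opp : n 2 0 * n0 2 0 < 0.
    by move: opp; have -> : (- n) 2 0 = - n 2 0 by [rewrite mxE]; lra.
  have [z|z|z] : [\/ 0 < n0 2 0, n0 2 0 < 0 | n0 2 0 = 0].
    by case: (ltgtP 0 (n0 2 0)) => z; [constructor 1|constructor 2|constructor 3].
  + have nz : n 2 0 < 0 by move: opp; rewrite pmulr_llt0.
    by move=> [_ /(_ (north_gt0 z))]; exact: north_lt0.
  + have nz : 0 < n 2 0 by move: opp; rewrite nmulr_llt0.
    by move=> [/(_ (north_gt0 nz)) + _]; exact: north_lt0.
  + by move: opp; rewrite z mulr0 ltxx.
- exists a => //; rewrite XE snormZ snorm_hat// mulr1 gtr0_norm//.
  by rewrite mulrC mulrA mulrCA T_w// mulfK// mulf_neq0// pnatr_eq0.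
Qed.

Hypothesis m_gt0 : (0 < m)%N.
Context (X01 X1 X2 : 'M[R]_3).
Hypothesis X01E : X01 = (snorm X0)^-1 *: X0.
Hypothesis sX1 : so3 X1.
Hypothesis sX2 : so3 X2.
Hypothesis X_normed : [/\ dot3 (vec X01) (vec X01) = 1, dot3 (vec X1) (vec X1) = 1
  & dot3 (vec X2) (vec X2) = 1].
Hypothesis X_orth : [/\ dot3 (vec X01) (vec X1) = 0, dot3 (vec X01) (vec X2) = 0
  & dot3 (vec X1) (vec X2) = 0].

(** All conclusions hold on a range where the denominators stay positive, where
    the third coordinate of the axis keeps the sign of that of [n0] (off the
    equator), and where the branch is within [C eps] of its value at [0]. *)
Lemma nonresonant_branch : exists2 l2, 0 < l2 <= l1 & forall l3, l3 <= l2 ->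
  [/\ Xf 0 = X0,
      forall l, 0 <= l < l3 -> forall i : int, snorm (Xf l) * T l <> 2 * i%:~R * pi
    & exists Xt : R -> 'M[R]_3,
      [/\ forall l, 0 <= l < l3 -> glued k (w l) (Xf l) (Xt l),
          vec X0 2 0 <> 0 -> forall l, 0 <= l < l3 -> Xt l = Xf l,
          CS m l3 Xt
        & exists a b c : R -> R, exists C : R, forall l, 0 <= l < l3 ->
            Xt l = (snorm X0 + a l) *: X01 + b l *: X1 + c l *: X2 /\
            [/\ `|a l| <= C * Num.sqrt l, `|b l| <= C * Num.sqrt l
              & `|c l| <= C * Num.sqrt l]]].
Proof.
have [X0p n01 X0E] := X0_polar.
have l1_gt0 : 0 < l1 by case/andP: l1_itv.
have [hC hp hE gC gE] := hg e0_itv.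
have LC := log_branch_Ck e0_itv den0.
have [C C0 LO] : exists2 C, 0 < C &
    \forall e \near (0 : R), `|log_branch e - log_branch 0| <= C * `|e|.
  by apply: diff_bigO; move: LC; case: (m) m_gt0 => // m' _; exact: Ck_at_diff.
have denC := Ck_at_cont (Ck_at_axis_den n0 gC).
have Pden : \forall e \near (0 : R), 0 < axis_den n0 (g e).
  exact: (cvgr_gt _ (denC : (fun e => axis_den n0 (g e)) @ 0 --> _) _ den0).
have Pax : vec X0 2 0 <> 0 -> \forall e \near (0 : R), 0 < axis n0 (g e) 2 0 * n0 2 0.
  move=> z0; have axC := Ck_at_cont (Ck_atM (Ck_at_axis 2 den0 gC)
    (Ck_at_cst m (0 : R) (n0 2 0))).
  apply: (cvgr_gt _ (axC : (fun e => axis n0 (g e) 2 0 * n0 2 0) @ 0 --> _)).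
  rewrite axis0.1 -expr2 lt_def sqr_ge0 andbT sqrf_eq0 mxE mulf_neq0//.
    by rewrite invr_eq0 gt_eqF.
  exact/eqP.
have Pax' : \forall e \near (0 : R), vec X0 2 0 <> 0 -> 0 < axis n0 (g e) 2 0 * n0 2 0.
  have [z|z] := pselect (vec X0 2 0 = 0); first by apply: (@filterE _ (nbhs (0 : R))) => e /(_ z).
  by apply: filterS (Pax z).
have [l2 l21 P] := near0_sqrt l1_gt0 (filterI Pden (filterI Pax' LO)).
have [l3 l31 CSl] := @Ck_at_CS _ _ _ _ (log_branch \o Num.sqrt) _ l1_gt0 LC.
have l4_l1 l : l < Num.min l2 l3 -> l < l1.
  by rewrite lt_min => /andP[_ /lt_le_trans]; apply; case/andP: l31.
have P4 l : 0 <= l < Num.min l2 l3 -> [/\ 0 <= l < l1, 0 < axis_den n0 (g (Num.sqrt l)),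
    (vec X0 2 0 <> 0 -> 0 < axis n0 (g (Num.sqrt l)) 2 0 * n0 2 0) &
    `|log_branch (Num.sqrt l) - X0| <= C * Num.sqrt l].
  move=> /andP[ll0 ll4]; have ll2 : 0 <= l < l2.
    by rewrite ll0; move: ll4; rewrite lt_min => /andP[].
  have [? []] := P _ (sqrt_lt_sqrt ll2).
  rewrite log_branch0 (ger0_norm (sqrtr_ge0 _)) => *; split => //.
  by rewrite ll0 l4_l1.
exists (Num.min l2 l3).
  rewrite lt_min; case/andP: l21 => -> l21; case/andP: l31 => -> _ /=.
  by rewrite ge_min l21.
have l4_0 : 0 <= (0 : R) < Num.min l2 l3.
  by rewrite lexx lt_min; case/andP: l21 => -> _; case/andP: l31 => ->.
move=> l5 l54; have P5 l : 0 <= l < l5 -> 0 <= l < Num.min l2 l3.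
  by move=> /andP[-> /lt_le_trans]; apply.
split.
- have [l00 d00 _ _] := P4 0 l4_0.
  have [_ + _] := log_branch_glued l00 d00.
  by rewrite sqrtr0 axis0.1 log_branch0 => <- //; right.
- move=> l /P5 hl i; have [hl1 den _ _] := P4 l hl.
  have [_ _ [a a2 ->]] := log_branch_glued hl1 den.
  move=> E; have {}E : a = 2 * (i - k%:Z)%:~R * pi.
    by rewrite rmorphB /= -pmulrn; lra.
  move: a2; rewrite E => /andP[x0 x1].
  have : 0 < (i - k%:Z)%:~R :> R by move: x0; rewrite -mulrA pmulr_rgt0// pmulr_lgt0.
  have : (i - k%:Z)%:~R < 1 :> R.
    by move: x1; rewrite -[ltRHS]mulr1 mulrAC ltr_pM2l// mulr_gt0.
  rewrite ltrz1 ltr0z.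
  by case: (i - k%:Z) => [[|[|n]]|n].
- exists (log_branch \o Num.sqrt); split => /=.
  + by move=> l /P5/P4[hl1 den _ _]; have [] := log_branch_glued hl1 den.
  + move=> z l /P5/P4[hl1 den /(_ z) ax _].
    by have [_ + _] := log_branch_glued hl1 den; apply; left.
  + apply: CSl => [|e he]; first by rewrite (le_trans l54)// ge_min lexx orbT.
    by rewrite /= sqrtr_sqr ger0_norm//; case/andP: he.
  + pose D l := vec (log_branch (Num.sqrt l) - X0).
    exists (fun l => dot3 (D l) (vec X01)), (fun l => dot3 (D l) (vec X1)),
      (fun l => dot3 (D l) (vec X2)).
    pose S (n : 'cV[R]_3) := \sum_i `|n i 0|.
    have S0 n : 0 <= S n by exact: sumr_ge0.
    exists ((S (vec X01) + S (vec X1) + S (vec X2)) * C) => l /P5/P4[hl1 den _ B].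
    have sD : so3 (log_branch (Num.sqrt l) - X0).
      rewrite /so3 linearB /= sX0 opprB opprK addrC; congr (_ + _).
      by rewrite /log_branch so3Z//; exact: hat_so3.
    have sX01 : so3 X01 by rewrite X01E; exact: so3Z.
    split.
      have X0E' : X0 = snorm X0 *: X01.
        by rewrite X01E scalerA divff ?gt_eqF// scale1r.
      have DE : hat (D l) = dot3 (D l) (vec X01) *: X01 + dot3 (D l) (vec X1) *: X1
          + dot3 (D l) (vec X2) *: X2.
        by rewrite {1}(orthonormal_decomp X_normed X_orth (D l)) !hatD !hatZ !vecK.
      rewrite scalerDl -X0E'.
      by rewrite -{1}(subrK X0 (log_branch _)) -{1}(vecK sD) DE addrC !addrA.
    have bd n : S n <= S (vec X01) + S (vec X1) + S (vec X2) ->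
        `|dot3 (D l) n| <= (S (vec X01) + S (vec X1) + S (vec X2)) * C * Num.sqrt l.
      move=> Sn; rewrite (le_trans (vec_bound _ _))// -mulrA.
      by apply: ler_pM => //; exact: S0.
    split; apply: bd; have := S0 (vec X01); have := S0 (vec X1); have := S0 (vec X2); lra.
Qed.

End Nonresonant.

Section Resonant.
Hypothesis m_gt0 : (0 < m)%N.
Hypothesis w_lin : exists C, forall l, 0 <= l < l0 -> `|w l - wbif| <= C * l.
Hypothesis res : resonant X0 wbif.
Context (Xf : R -> 'M[R]_3).
Hypothesis Xf0 : Xf 0 = X0.
Hypothesis XfE : forall l, 0 < l < l0 ->
  (snorm (Xperiod w Z l) <> 0 -> Xf l = lifted k (w l) (Xperiod w Z l)) /\
  (snorm (Xperiod w Z l) = 0 -> exists Q, [/\ so3 Q, snorm Q = 1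
      & Xf l = Xperiod w Z l + (k%:R * `|w l|) *: Q]).

(** In resonance [al0] is an integer multiple of [2 pi]. *)
Lemma resonant_al0 : al0 = 0.
Proof.
have [i _ iE] := res.
have {}iE : 2 * pi * `|i|%N%:R = al0 + 2 * k%:R * pi.
  rewrite -al0_k -[snorm X0]ger0_norm ?snorm_ge0// iE normrM natr_absz intr_norm.
  by have wn : `|wbif| != 0 by [rewrite gt_eqF]; move: (@pi R) => p; field.
move: al0_itv; have -> : al0 = 2 * pi * (`|i|%N%:Z - k%:Z)%:~R.
  by rewrite rmorphB /= -!pmulrn; lra.
have pp : 0 < 2 * pi :> R by rewrite mulr_gt0.
rewrite pmulr_rge0// -[ltRHS]mulr1 ltr_pM2l// ler0z ltrz1.
by case: (_ - _) => [[|n]|n] //; rewrite mulr0.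
Qed.

Let snormX0k : snorm X0 = k%:R * `|wbif|.
Proof. by rewrite snormX0E resonant_al0; move: (@pi R) pin => p pn; field. Qed.

(** The norm of the glued branch of [X^f] in resonance, as a function of [eps]. *)
Definition norm_branch (e : R) : R :=
  (small_angle (g e) + 2 * k%:R * pi) * h e / (2 * pi).

Let g0_1 : g 0 = 1%:M.
Proof. by have [_ _ _ _ ->] := hg0; rewrite resonant_al0 rotmx0. Qed.

Let tr1 : \tr (1%:M : 'M[R]_3) = 3.
Proof. by rewrite mxtrace1. Qed.

Lemma small_angle1 : small_angle (1%:M : 'M[R]_3) = 0.
Proof. by rewrite /small_angle tr1 subrr mul0r sqrtr0 atan0 mulr0. Qed.

(** Gluing is used to replace an angle [a > pi] by [2 pi - a], which is close to [0]
    like the small angle.  The rotations by [pi], where the formula for the small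
    angle divides by zero, are excluded by the trace. *)
Lemma norm_branch_glued l : 0 <= l < l1 -> -1 < \tr (g (Num.sqrt l)) ->
  exists2 X', glued k (w l) (Xf l) X' & snorm X' = norm_branch (Num.sqrt l).
Proof.
move=> hl; have wl := w_gt0 hl; have [_ _ hE _ _] := hg (sqrt_lt_sqrt hl).
have {}hE : h (Num.sqrt l) = `|w l| by rewrite hE sqr_sqrtr//; case/andP: hl.
have [a [n [n1 a2 ZE gE nn0]]] := monodromy_polar hl.
have [hl0|hl0] : l = 0 \/ 0 < l.
  by case/andP: hl; rewrite le_eqVlt => /orP[/eqP|]; auto.
- move=> _; exists X0; first by left; rewrite hl0 Xf0.
  have -> : norm_branch (Num.sqrt l) = k%:R * `|w l|.
    rewrite /norm_branch hE hl0 sqrtr0 g0_1 small_angle1 add0r.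
    by move: (@pi R) pin => p pn; field.
  by rewrite hl0 w0.
- have hl' : 0 < l < l0.
    by rewrite hl0; case/andP: l1_itv => _; case/andP: hl => _ /lt_le_trans; apply.
  have [XfE1 XfE2] := XfE hl'; rewrite gE => tr.
  have [X0E|Xn0] := pselect (snorm (Xperiod w Z l) = 0).
    have [Q [sQ Q1 ->]] := XfE2 X0E.
    have [_ sX eX] := unit_frequency hl sQ Q1 X0E.
    eexists; [by left|]; rewrite sX /norm_branch gE hE.
    have Z00 := Xperiod_eq0 hl X0E.
    have -> : rotmx a n = 1%:M by rewrite -expm_hat// -ZE Z00 expm0.
    by rewrite small_angle1 add0r; move: (@pi R) pin => p pn; field.
  have a0 : 0 < a.
    case/andP: a2; rewrite le_eqVlt => /orP[/eqP E|//]; exfalso; apply: Xn0.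
    by rewrite /Xperiod -/(T l) ZE -E scale0r scaler0 snorm0.
  have sc b (n' : 'cV[R]_3) : dot3 n' n' = 1 -> 0 < b ->
      snorm (((b + 2 * k%:R * pi) * `|w l| / (2 * pi)) *: hat n') =
      (b + 2 * k%:R * pi) * `|w l| / (2 * pi).
    move=> n1' b0; rewrite snormZ snorm_hat// mulr1 gtr0_norm//.
    by rewrite divr_gt0 ?mulr_gt0// ltr_wpDr// !mulr_ge0// ltW.
  rewrite XfE1// (lifted_polar n1 a0 wl ZE) /norm_branch gE hE.
  have [[ap ->]|[ap ->]] := small_angle_rot n1 a2 tr.
    by eexists; [by left|]; rewrite sc.
  eexists; first exact: glued_polar.
  rewrite sc//; first by rewrite -scaleN1r dot3Zl dot3Zr n1; ring.
  by case/andP: a2; lra.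
Qed.

Lemma norm_branch_continuous e : 0 <= e < Num.sqrt l1 -> -1 < \tr (g e) ->
  {for e, continuous norm_branch}.
Proof.
move=> he tr; have [hC _ _ gC _] := hg he.
have trC := Ck_at_trace gC.
have qC : {for e, continuous (fun e => (3 - \tr (g e)) / (1 + \tr (g e)))}.
  apply: (@Ck_at_cont _ m); apply: Ck_atM.
    by apply: Ck_atB => //; exact: Ck_at_cst.
  apply: Ck_atV; last by apply: Ck_atD => //; exact: Ck_at_cst.
  by rewrite gt_eqF//; lra.
apply: continuousM; last exact: cst_continuous.
apply: continuousM; last exact: Ck_at_cont hC.
apply: continuousD; last exact: cst_continuous.
apply: continuousM; first exact: cst_continuous.
apply: continuous_comp; last exact: continuous_atan.
by apply: continuous_comp => //; exact: sqrt_continuous.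
Qed.

(** [atan x <= x], and the trace is bounded away from [-1]. *)
Lemma small_angle_bound (A : 'M[R]_3) (c : R) : 0 <= c -> 0 <= \tr A -> `|\tr A - 3| <= c ->
  0 <= small_angle A <= 2 * Num.sqrt c.
Proof.
move=> c0 tr0 trc; have [s0 s1] := andP (atan_le (sqrtr_ge0 ((3 - \tr A) / (1 + \tr A)))).
rewrite /small_angle mulr_ge0//= ler_pM2l//.
apply: le_trans s1 _; rewrite ler_wsqrtr// ler_pdivrMr; last by lra.
have : 3 - \tr A <= c by move: trc; rewrite distrC; apply: le_trans; exact: ler_norm.
by nra.
Qed.

(** The rate comes from [3 - tr (g eps) <= C eps] under a square root; the variation
    of [|omega|] is of the smaller order [lambda]. *)
Lemma resonant_branch : exists2 l2, 0 < l2 <= l1 & forall l3, l3 <= l2 ->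
  exists Xt : R -> 'M[R]_3,
    [/\ forall l, 0 <= l < l3 -> glued k (w l) (Xf l) (Xt l),
        {within `[0, l3[, continuous (fun l => snorm (Xt l))}
      & exists C : R, forall l, 0 <= l < l3 ->
          `|snorm (Xt l) - snorm X0| <= C * l `^ (4^-1)].
Proof.
have l1_gt0 : 0 < l1 by case/andP: l1_itv.
have [hC hp hE gC _] := hg0.
have trC := Ck_at_trace gC.
have [C C0 trO] : exists2 C, 0 < C &
    \forall e \near (0 : R), `|\tr (g e) - \tr (g 0)| <= C * `|e|.
  by apply: diff_bigO; move: trC; case: (m) m_gt0 => // m' _; exact: Ck_at_diff.
have [D hD] := w_lin.
have Ptr : \forall e \near (0 : R), 0 < \tr (g e).
  apply: (cvgr_gt _ (Ck_at_cont trC : (fun e => \tr (g e)) @ 0 --> _)).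
  by rewrite g0_1 tr1.
have P1 : \forall e \near (0 : R), e < 1 by exact: lt_nbhsl.
have [l2 l21 P] := near0_sqrt l1_gt0 (filterI Ptr (filterI trO P1)).
have l2l1 l : 0 <= l < l2 -> 0 <= l < l1.
  by case/andP: l21 => _ l21 /andP[-> /lt_le_trans]; apply.
have P2 l : 0 <= l < l2 -> 0 < \tr (g (Num.sqrt l)) by move=> /sqrt_lt_sqrt /P[].
exists l2 => //.
have /choice[Xt XtE] : forall l, exists X', 0 <= l < l2 ->
    glued k (w l) (Xf l) X' /\ snorm X' = norm_branch (Num.sqrt l).
  move=> l; have [hl|hl] := pselect (0 <= l < l2); last by exists 0 => /hl.
  have [|X' X1 X2] := @norm_branch_glued l (l2l1 _ hl); last by exists X'.
  by have := P2 l hl; lra.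
move=> l3 l32; have l3l2 l : 0 <= l < l3 -> 0 <= l < l2.
  by move=> /andP[-> /lt_le_trans]; apply.
exists Xt; split.
- by move=> l /l3l2/XtE[].
- apply: (@subspace_eq_continuous _ _ _ (norm_branch \o Num.sqrt)).
    move=> l; rewrite inE /= in_itv /= => /andP[ll0 ll3].
    have hl : 0 <= l < l2 by rewrite ll0 (lt_le_trans ll3).
    by have [_ <-] := XtE l hl.
  apply: continuous_in_subspaceT => l; rewrite inE /= in_itv /= => /andP[ll0 ll3].
  have hl : 0 <= l < l2 by rewrite ll0 (lt_le_trans ll3).
  apply: continuous_comp; first exact: sqrt_continuous.
  apply: norm_branch_continuous; first exact/sqrt_lt_sqrt/l2l1.
  by have := P2 l hl; lra.
- exists (2 * Num.sqrt C * (`|wbif| + `|D|) / (2 * pi) + k%:R * `|D|) => l /l3l2 hl.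
  have [_ ->] := XtE l hl; have [ll0 ll2] := andP hl.
  have [tr0 [trl sl1]] := P _ (sqrt_lt_sqrt hl).
  set e := Num.sqrt l in tr0 trl sl1 *.
  have e0 : 0 <= e by exact: sqrtr_ge0.
  rewrite g0_1 tr1 (ger0_norm e0) in trl.
  have [t0 t1] := andP (small_angle_bound (mulr_ge0 (ltW C0) e0) (ltW tr0) trl).
  rewrite sqrtrM ?(ltW C0)// in t1.
  have qE : l `^ 4^-1 = Num.sqrt e.
    by rewrite -powR12_sqrt// /e -powR12_sqrt// -powRrM; congr (_ `^ _); field.
  rewrite qE; set s := Num.sqrt e in t1 *.
  have s0 : 0 <= s by exact: sqrtr_ge0.
  have sE : e = s ^+ 2 by rewrite sqr_sqrtr.
  have s1 : s <= 1 by rewrite -sqrtr1 ler_wsqrtr// ltW.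
  have lE : l = s ^+ 4 by rewrite -[4%N]/(2 * 2)%N exprM -sE sqr_sqrtr.
  have hl0 : 0 <= l < l0.
    by case/andP: l1_itv => _; case/andP: (l2l1 _ hl) => -> /lt_le_trans; apply.
  have he : h e = `|w l|.
    by have [_ _ -> _ _] := hg (sqrt_lt_sqrt (l2l1 _ hl)); rewrite sqr_sqrtr.
  have dw : `| (`|w l| - `|wbif|) | <= `|D| * s.
    rewrite (le_trans (ler_dist_dist _ _))// (le_trans (hD l hl0))//.
    rewrite (le_trans (ler_norm _))// normrM ler_wpM2l// ger0_norm// lE.
    by rewrite exprS ler_piMr// exprn_ile1.
  have wB : `|w l| <= `|wbif| + `|D|.
    have := ler_norm (`|w l| - `|wbif|); have : `|D| * s <= `|D| by rewrite ler_piMr.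
    by lra.
  have -> : norm_branch e - snorm X0 =
      small_angle (g e) * `|w l| / (2 * pi) + k%:R * (`|w l| - `|wbif|).
    rewrite /norm_branch he snormX0k; move: (@pi R) pin => p pn; by field.
  apply: le_trans (ler_normD _ _) _; rewrite [leRHS]mulrDl; apply: lerD; last first.
    by rewrite normrM ger0_norm// -mulrA ler_wpM2l.
  have p2 : 0 < 2 * pi :> R by rewrite mulr_gt0.
  rewrite ger0_norm; last by apply: divr_ge0; [exact: mulr_ge0|exact: ltW].
  rewrite [leRHS]mulrAC ler_pM2r ?invr_gt0//.
  apply: le_trans (ler_pM t0 (normr_ge0 _) t1 wB) _.
  by rewrite mulrA mulrAC.
Qed.

End Resonant.

End Branch.

(** * First return of the reduced flow *)

Section Shift.
Context {R : realType}.

Lemma is_derive_shift_arg (W : normedModType R) (x : R -> W) (s t : R) (v : W) :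
  is_derive (t + s) (1 : R) x v -> is_derive t (1 : R) (fun u => x (u + s)) v.
Proof.
have E : (fun h : R => h^-1 *: (((fun u => x (u + s)) \o shift t) (h *: (1 : R)) -
    (fun u => x (u + s)) t)) =
  (fun h : R => h^-1 *: ((x \o shift (t + s)) (h *: (1 : R)) - x (t + s))).
  by apply/funext => h /=; rewrite addrA.
by move=> [d e]; split; [rewrite /derivable E|rewrite /derive E].
Qed.

Lemma ode_halfline_shift (W : normedModType R) (f : R -> W -> W) (x : R -> W)
    (s tau : R) : 0 <= s -> ode_halfline f x ->
  ode_on tau (fun t => f (t + s)) (fun t => x (t + s)).
Proof.
move=> s0 [/subspace_continuousP cx dx]; split.
  apply/subspace_continuousP => t; rewrite /= in_itv /= => /andP[t0 _].
  have ts0 : `[0, +oo[%classic (t + s) by rewrite /= in_itv /= andbT addr_ge0.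
  have st : (fun u : R => u + s) u @[u --> within `[0, tau] (nbhs t)] -->
      within `[0, +oo[ (nbhs (t + s)).
    move=> B; rewrite /within /= => HB.
    have cs : {for (t : R), continuous (fun u : R => u + s)}.
      exact: (Ck_at_cont (Ck_atD (@Ck_at_id _ 0 _ (t : R)) (Ck_at_cst 0 (t : R) s))).
    have HB' : nbhs (t : R) (fun u : R => `[0, +oo[%classic (u + s) -> B (u + s)).
      exact: cs _ HB.
    apply: (@filterS R (nbhs (t : R)) _ _ _ _ HB') => u /= Bu.
    rewrite in_itv /= => /andP[u0 _].
    by apply: Bu; rewrite in_itv /= andbT addr_ge0.
  exact: cvg_comp st (cx _ ts0).
move=> t /andP[t0 _]; apply: is_derive_shift_arg; apply: dx.
by rewrite ltr_wpDr.
Qed.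

Lemma ode_halfline_on (W : normedModType R) (f : R -> W -> W) (x : R -> W)
    (tau : R) : ode_halfline f x -> ode_on tau f x.
Proof.
move=> /(@ode_halfline_shift _ _ _ 0 tau (lexx 0)).
have -> : (fun t => f (t + 0)) = f by apply/funext => t; rewrite addr0.
by have -> : (fun t => x (t + 0)) = x by apply/funext => t; rewrite addr0.
Qed.

Lemma mulmxl_continuous n (C : 'M[R]_n) : continuous (fun M : 'M[R]_n => C *m M).
Proof.
have -> : (fun M : 'M[R]_n => C *m M) =
    (fun M => \sum_i \sum_j M i j *: (C *m delta_mx i j)).
  apply/funext => M; rewrite {1}(matrix_sum_delta M) mulmx_sumr.
  apply: eq_bigr => i _; rewrite mulmx_sumr; apply: eq_bigr => j _.
  by rewrite scalemxAr.
move=> M; apply: (@Ck_at_cont _ 0); apply: Ck_at_sum => i; apply: Ck_at_sum => j.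
by apply: Ck_atZl; apply: Ck_at_coord; exact: Ck_at_id.
Qed.

(** The equivariance of the skew product: [A] enters its own equation only as a
    left factor. *)
Lemma ode_on_mull n (X : R -> 'M[R]_n) (C : 'M[R]_n) (A : R -> 'M[R]_n) tau :
  ode_on tau (fun t B => B *m X t) A ->
  ode_on tau (fun t B => B *m X t) (fun t => C *m A t).
Proof.
move=> [cA dA]; split.
  move/subspace_continuousP: cA => cA; apply/subspace_continuousP => t ht.
  exact: (cvg_comp _ _ (cA t ht) (@mulmxl_continuous _ C (A t))).
move=> t ht; have [dAt At] := dA t ht.
have {}dAt : differentiable A t by apply/derivable1_diffP.
pose L : {linear 'M[R]_n -> 'M[R]_n} := mulmx C.
have cL : continuous L by exact: mulmxl_continuous.
have dL : differentiable L (A t) by exact: linear_differentiable.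
have dLA : differentiable (L \o A) t by exact: differentiable_comp.
have vE : 'D_1 (L \o A) t = C *m (A t *m X t).
  by rewrite deriveE// diff_comp//= diff_lin// -deriveE// At.
rewrite -mulmxA -vE; apply: DeriveDef => //.
exact/derivable1_diffP.
Qed.

End Shift.

Section Return.
Context {R : realType} {Ya : Type} (act : 'M[R]_3 -> Ya -> Ya)
  (Phi : R -> Ya -> R -> option Ya) (Psi : 'rV[R]_2 -> Ya) (delta l : R)
  (XG : 'rV[R]_2 * R -> 'M[R]_3) (XN : 'rV[R]_2 * R -> 'rV[R]_2).
Hypothesis chart_inj : forall A B q q', SO3 A -> SO3 B -> `|q| < delta ->
  `|q'| < delta -> act A (Psi q) = act B (Psi q') -> A = B /\ q = q'.
Hypothesis flow : forall tau A q, 0 <= tau ->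
  (forall t, 0 <= t <= tau -> SO3 (A t) /\ `|q t| < delta) ->
  is_reduced_solution XG XN l tau A q ->
  forall t, 0 <= t <= tau ->
    Phi t (act (A 0) (Psi (q 0))) l = Some (act (A t) (Psi (q t))).
Context (A : R -> 'M[R]_3) (q : R -> 'rV[R]_2).
Hypothesis A_SO3 : forall t, 0 <= t -> SO3 (A t).
Hypothesis q_small : forall t, 0 <= t -> `|q t| < delta.
Hypothesis A0 : A 0 = 1%:M.
Hypothesis act1 : act 1%:M (Psi (q 0)) = Psi (q 0).
Hypothesis A_ode : ode_halfline (fun t B => B *m XG (q t, l)) A.
Hypothesis q_ode : ode_halfline (fun _ x => XN (x, l)) q.

Lemma reduced_flow t : 0 <= t ->
  Phi t (Psi (q 0)) l = Some (act (A t) (Psi (q t))).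
Proof.
move=> t0; rewrite -{1}act1 -A0; apply: (flow t0) => //; last by rewrite t0 /=.
  by move=> s /andP[s0 _]; split; auto.
by split; exact: ode_halfline_on.
Qed.

Lemma SO3_mul (B C : 'M[R]_3) : SO3 B -> SO3 C -> SO3 (B *m C).
Proof.
move=> [B1 Bd] [C1 Cd]; split; last by rewrite det_mulmx Bd Cd mulr1.
by rewrite trmx_mul mulmxA -(mulmxA B) C1 mulmx1.
Qed.

(** The shifted solution and the solution multiplied by [A s] represent the same
    trajectory; comparing them in the chart replaces the uniqueness theorem for the
    equation of [q]. *)
Lemma return_period s : 0 <= s -> in_group_orbit act (Psi (q 0)) (Phi s (Psi (q 0)) l) ->
  forall t, 0 <= t -> q (t + s) = q t.
Proof.
move=> s0 [B BSO]; rewrite reduced_flow// => -[].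
move=> /(chart_inj (A_SO3 s0) BSO (q_small s0) (q_small (lexx 0)))[_ qs] t t0.
have As := A_SO3 s0.
have t0t : 0 <= t <= t by rewrite t0 /=.
have F1 : Phi t (act (A s) (Psi (q s))) l = Some (act (A (t + s)) (Psi (q (t + s)))).
  have := @flow t (fun u => A (u + s)) (fun u => q (u + s)) t0.
  rewrite add0r; apply => //.
    by move=> u /andP[u0 _]; split; [apply: A_SO3|apply: q_small]; rewrite addr_ge0.
  by split; [exact: (ode_halfline_shift _ s0 A_ode)|
    exact: (ode_halfline_shift _ s0 q_ode)].
have F2 : Phi t (act (A s) (Psi (q 0))) l = Some (act (A s *m A t) (Psi (q t))).
  have := @flow t (fun u => A s *m A u) q t0.
  rewrite A0 mulmx1; apply => //.
    by move=> u /andP[u0 _]; split; [exact: SO3_mul (A_SO3 u0)|exact: q_small].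
  by split; [apply: ode_on_mull|]; exact: ode_halfline_on.
move: F1; rewrite qs F2 => -[E].
have ts0 : 0 <= t + s by rewrite addr_ge0.
by have [] := chart_inj (SO3_mul As (A_SO3 t0)) (A_SO3 ts0) (q_small t0)
  (q_small ts0) E.
Qed.

Lemma return_primary_frequency T X : least_period q T -> so3 X ->
  expm (T *: X) = A T -> is_primary_frequency act Phi (Psi (q 0)) l T X.
Proof.
move=> [T0 qT qmin] sX eX.
have PhiT : Phi T (Psi (q 0)) l = Some (act (A T) (Psi (q 0))).
  by rewrite reduced_flow ?(ltW T0)// -{2}[T]add0r qT.
split; [by []|split => //|by rewrite eX].
  by exists (A T) => //; exact/A_SO3/ltW.
move=> t /[dup] tT /andP[t0 _] /(return_period (ltW t0)).
exact: qmin.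
Qed.

End Return.

(** * Primary frequencies near the Hopf bifurcation *)

Theorem corollary5p8 (R : realType) (m : nat) (hm : (1 <= m)%N) :
  exists M : nat,
  forall
    (* the equation *)
    (r : R) (hr : 0 < r) (N : nat) (hN : (1 <= N)%N)
    (d : 'I_N -> R) (hd : forall i, 0 <= d i)
    (F : 'cV[R]_N * R -> 'cV[R]_N)
    (p : option nat) (hp : if p is Some n then (3 <= n)%N else true)
    (hF : forall k, (if p is Some n then (k <= n.+2)%N else true) -> Ck k setT F)
    (hF0 : forall l, F (0, l) = 0)
    (* the phase spaces Y and Y^al, and the semiflow *)
    (Y : completeNormedModType R) (rep : Y -> 'cV[R]_3 -> 'cV[R]_N)
    (hY : is_model_of_Y r d rep)
    (al : R) (hal : 2^-1 < al < 1)
    (Ya : completeNormedModType R) (j : {linear Ya -> Y})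
    (hYa : is_model_of_Yal r d al rep j)
    (Phi : R -> Ya -> R -> option Ya)
    (hPhi : is_local_semiflow r d F rep j M Phi)
    (* the relative equilibrium and its linearization *)
    (u0 : Ya) (X0 : 'M[R]_3) (hX0 : so3 X0) (hX0n : X0 <> 0)
    (hu0 : is_relative_equilibrium r rep j Phi u0 X0)
    (P : {linear Y -> Y})
    (hP : spectral_assumption (Lop r d F rep j u0 X0) P)
    (* the center manifold reduction *)
    (e : {linear 'rV[R]_2 -> Y}) (he : is_basis_of_Vstar r rep j P u0 e)
    (delta : R) (hdelta : 0 < delta) (Psi : 'rV[R]_2 -> Ya)
    (hPsi : is_center_manifold_chart r rep j M P u0 delta Psi)
    (XG : 'rV[R]_2 * R -> 'M[R]_3) (XN : 'rV[R]_2 * R -> 'rV[R]_2)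
    (hXG : Ck M setT XG) (hXN : Ck M setT XN)
    (hXGso3 : forall z, so3 (XG z))
    (hXG0 : XG (0, 0) = X0) (hXN0 : XN (0, 0) = 0)
    (hred : solutions_correspond r rep j Phi Psi delta XG XN)
    (* the Hopf bifurcation *)
    (l0 : R) (hl0 : 0 < l0) (wbif : R) (w : R -> R) (q : R -> R -> 'rV[R]_2)
    (hHopf : supercritical_Hopf M XN wbif l0 w q)
    (* the basis of so(3) *)
    (X01 X1 X2 : 'M[R]_3) (hX01 : X01 = (snorm X0)^-1 *: X0)
    (hX1 : so3 X1) (hX2 : so3 X2)
    (hnorm : [/\ dot3 (vec X01) (vec X01) = 1, dot3 (vec X1) (vec X1) = 1
               & dot3 (vec X2) (vec X2) = 1])
    (horth : [/\ dot3 (vec X01) (vec X1) = 0, dot3 (vec X01) (vec X2) = 0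
               & dot3 (vec X1) (vec X2) = 0])
    (hbr : [/\ bracket X01 X1 = X2, bracket X1 X2 = X01 & bracket X2 X01 = X1])
    (* A, Z, k and X^f *)
    (A : R -> R -> 'M[R]_3)
    (hA0 : forall l, 0 <= l < l0 -> A 0 l = 1%:M)
    (hA : forall l, 0 <= l < l0 ->
       ode_halfline (fun t B => B *m XG (q t l, l)) (A^~ l))
    (Z : R -> R -> 'M[R]_3)
    (hZ : forall t l, 0 <= t -> 0 <= l < l0 ->
       qD X0 (Z t l) /\ A t l = expm (Z t l))
    (hZCS : CSt_qD M l0 Z)
    (k : nat) (al0 : R) (hal0 : 0 <= al0 < 2 * pi)
    (hk : 2 * pi * snorm X0 / `|wbif| = al0 + 2 * k%:R * pi)
    (Xf : R -> 'M[R]_3)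
    (hXf1 : nonresonant X0 wbif ->
       forall l, 0 <= l < l0 -> Xf l = lifted k (w l) (Xperiod w Z l))
    (hXf2 : resonant X0 wbif ->
       Xf 0 = X0 /\
       forall l, 0 < l < l0 ->
         (snorm (Xperiod w Z l) <> 0 -> Xf l = lifted k (w l) (Xperiod w Z l)) /\
         (snorm (Xperiod w Z l) = 0 -> exists Q, [/\ so3 Q, snorm Q = 1
            & Xf l = Xperiod w Z l + (k%:R * `|w l|) *: Q])),
  exists2 l1, 0 < l1 <= l0 &
  [/\ forall l, 0 < l < l1 ->
        is_primary_frequency (actYa r rep j) Phi (Psi (q 0 l)) l
          (2 * pi / `|w l|) (Xf l),
      Xf 0 = X0,
      nonresonant X0 wbif ->
        (exists Xt : R -> 'M[R]_3,
          [/\ forall l, 0 <= l < l1 -> glued k (w l) (Xf l) (Xt l),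
              (* Xt is X^f itself unless X0 lies on the equator *)
              vec X0 2 0 <> 0 -> forall l, 0 <= l < l1 -> Xt l = Xf l,
              CS m l1 Xt
            & exists a b c : R -> R, exists C : R, forall l, 0 <= l < l1 ->
                Xt l = (snorm X0 + a l) *: X01 + b l *: X1 + c l *: X2 /\
                [/\ `|a l| <= C * Num.sqrt l, `|b l| <= C * Num.sqrt l
                  & `|c l| <= C * Num.sqrt l]]) /\
        (forall l, 0 < l < l1 ->
          is_modulated_rotating_wave (actYa r rep j) Phi (Psi (q 0 l)) l)
    & resonant X0 wbif ->
        exists Xt : R -> 'M[R]_3,
          [/\ forall l, 0 <= l < l1 -> glued k (w l) (Xf l) (Xt l),
              {within `[0, l1[, continuous (fun l => snorm (Xt l))}
            & exists C : R, forall l, 0 <= l < l1 ->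
                `|snorm (Xt l) - snorm X0| <= C * l `^ (4^-1)]].
Proof.
exists m => r hr N hN d hd F p hp hF hF0 Y rep hY al hal Ya j hYa Phi hPhi u0 X0 hX0 hX0n
  hu0 P hP e he delta hdelta Psi hPsi XG XN hXG hXN hXGso3 hXG0 hXN0 hred l0 hl0
  wbif w q hHopf X01 X1 X2 hX01 hX1 hX2 hnorm horth hbr A hA0 hA Z hZ hZCS k al0 hal0 hk
  Xf hXf1 hXf2.
pose act := actYa r rep j.
have act1 u : act 1%:M u = u by exact: actYa1 hYa u.
have [lred lred0 red] := hred.
have [Psi0 chart_inj _ _ _] := hPsi.
have [_ [wn _] [_ q0 [Cq hCq]] [wCS [Cw hCw]] hq] := hHopf.
have l00 : 0 <= (0 : R) < l0 by rewrite lexx.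
have w0 : w 0 = wbif.
  have := hCw 0 l00; rewrite mulr0 normr_le0 subr_eq0.
  by move=> /eqP.
have A_SO3 l t : 0 <= l < l0 -> 0 <= t -> SO3 (A t l).
  by move=> hl t0; have [ZD ->] := hZ t l t0 hl; have [sZ _ _] := qDP ZD; exact: expm_SO3.
(* The reduced solution with [q = 0] and the relative equilibrium are the same
   trajectory. *)
have A_0 t : 0 <= t -> A t 0 = expm (t *: X0).
  move=> t0; have [re _ _] := hu0.
  have lr : `|0 : R| < lred by rewrite normr0.
  have dd : `|0 : 'rV[R]_2| < delta by rewrite normr0.
  have SA (s : R) : 0 <= s <= t -> SO3 (A s 0) /\ `|cst 0 s : 'rV[R]_2| < delta.
    by move=> /andP[s0 _]; split => //; exact: A_SO3.
  have [+ _] := red 0 t (A^~ 0) (cst 0) lr t0 SA.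
  move=> /(_ _ t); rewrite -/act lexx t0 /= hA0// act1 Psi0 re// => H.
  have {}H : Some (act (expm (t *: X0)) (Psi 0)) = Some (act (A t 0) (Psi 0)).
    rewrite Psi0; apply: H => //; split.
      have [cA dA] := ode_halfline_on t (hA 0 l00); split=> // s /[dup] hs /andP[s0 _].
      by have := dA s hs; rewrite (q0 s (ltW s0)).
    split; first by apply: continuous_subspaceT => s; exact: cst_continuous.
    by move=> s _; rewrite hXN0; exact: is_derive_cst.
  case: H => H; have SX : SO3 (expm (t *: X0)) by exact/expm_SO3/so3Z.
  by have [->] := chart_inj _ _ _ _ SX (A_SO3 0 t l00 t0) dd dd H.
have T0 : 0 <= 2 * pi / `|wbif| by rewrite divr_ge0 ?mulr_ge0 ?pi_ge0.
have Z0 : expm (Z (2 * pi / `|wbif|) 0) = expm ((2 * pi / `|wbif|) *: X0).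
  by rewrite -A_0//; have [_ ->] := hZ _ 0 T0 l00.
have ZD t l : 0 <= t -> 0 <= l < l0 -> qD X0 (Z t l).
  by move=> t0 hl; have [] := hZ t l t0 hl.
have [l1 [h [g [l1_itv hg]]]] := monodromy_ext hl0 wn wCS w0 hZCS.
have l1_gt0 : 0 < l1 by case/andP: l1_itv.
(* The range where the Hopf solution, of size [Cq * sqrt l], stays in the chart. *)
pose lq := Num.min lred ((delta / (`|Cq| + 1)) ^+ 2).
have lq0 : 0 < lq by rewrite lt_min lred0 exprn_gt0// divr_gt0// ltr_wpDl.
have q_small l t : 0 < l < Num.min l1 lq -> 0 <= t -> `|q t l| < delta.
  move=> /andP[lp]; rewrite !lt_min => /and3P[ll1 _ ld] t0.
  have ll0 : 0 <= l < l0.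
    by rewrite (ltW lp) (lt_le_trans ll1)//; case/andP: l1_itv.
  apply: le_lt_trans (hCq t l t0 ll0) _.
  have dC : 0 < delta / (`|Cq| + 1) by rewrite divr_gt0// ltr_wpDl.
  have : Num.sqrt l < delta / (`|Cq| + 1).
    by rewrite -[ltRHS](ger0_norm (ltW dC)) -sqrtr_sqr ltr_sqrt// exprn_gt0.
  rewrite ltr_pdivlMr ?ltr_wpDl// mulrC; apply: le_lt_trans.
  by rewrite ler_wpM2r ?sqrtr_ge0// (le_trans (ler_norm _))// lerDl.
have Xf_freq l : 0 < l < l1 -> so3 (Xf l) /\
    expm ((2 * pi / `|w l|) *: Xf l) = expm (Z (2 * pi / `|w l|) l).
  move=> /[dup] hl' /andP[lp ll1].
  have hl : 0 <= l < l1 by rewrite ltW.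
  have hll0 : l < l0 by rewrite (lt_le_trans ll1)//; case/andP: l1_itv.
  have lift := lifted_frequency k ZD l1_itv hg hl.
  have [nres|res] := nonresonant_or_resonant wbif hX0 hX0n.
    by rewrite hXf1// (ltW lp).
  have [_ /(_ l)] := hXf2 res; rewrite lp hll0 => /(_ isT)[X_n0 X_0].
  have [X0E|/X_n0 ->//] := pselect (snorm (Xperiod w Z l) = 0).
  have [Q [sQ Q1 ->]] := X_0 X0E.
  by have [] := unit_frequency k ZD l1_itv hg hl sQ Q1 X0E.
have primary l : 0 < l < Num.min l1 lq ->
    is_primary_frequency act Phi (Psi (q 0 l)) l (2 * pi / `|w l|) (Xf l).
  move=> /[dup] hlq /andP[lp]; rewrite !lt_min => /and3P[ll1 llr _].
  have hl0' : 0 < l < l0.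
    by rewrite lp (lt_le_trans ll1)//; case/andP: l1_itv.
  have hl0'' : 0 <= l < l0 by case/andP: hl0' => /ltW -> ->.
  have [qode qper _] := hq l hl0'.
  have [sX eX] : so3 (Xf l) /\
    expm ((2 * pi / `|w l|) *: Xf l) = expm (Z (2 * pi / `|w l|) l).
    by apply: Xf_freq; rewrite lp.
  have Tl : 0 <= 2 * pi / `|w l| by rewrite divr_ge0 ?mulr_ge0 ?pi_ge0.
  have flow tau B x : 0 <= tau ->
      (forall t, 0 <= t <= tau -> SO3 (B t) /\ `|x t| < delta) ->
      is_reduced_solution XG XN l tau B x ->
      forall t, 0 <= t <= tau ->
        Phi t (act (B 0) (Psi (x 0))) l = Some (act (B t) (Psi (x t))).
    by move=> tau0 Bx sol; apply/(red l tau B x) => //; rewrite ger0_norm// ltW.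
  apply: (return_primary_frequency (A := A^~ l) (q := q^~ l) chart_inj flow).
  - by move=> t t0; exact: A_SO3.
  - by move=> t; exact: q_small.
  - exact: hA0.
  - exact: act1.
  - exact: hA.
  - exact: qode.
  - exact: qper.
  - exact: sX.
  - by rewrite eX; have [_ ->] := hZ _ l Tl hl0''.
have cut l2 : 0 < l2 <= l1 -> [/\ 0 < Num.min l2 lq <= l0, Num.min l2 lq <= l2
    & forall l, 0 < l < Num.min l2 lq -> 0 < l < Num.min l1 lq].
  move=> /andP[l20 l21]; split; last 1 first.
  - move=> l /andP[->]; rewrite !lt_min => /andP[ll2 ->].
    by rewrite (lt_le_trans ll2).
  - rewrite lt_min l20 lq0 ge_min /=; apply/orP; left; apply: le_trans l21 _.
    by case/andP: l1_itv.
  - by rewrite ge_min lexx.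
have [nres|res] := nonresonant_or_resonant wbif hX0 hX0n.
  have [l2 /cut[l3_itv l32 l31] B] := nonresonant_branch hX0 hX0n wn w0 ZD Z0 hal0 hk
    l1_itv hg nres (hXf1 nres) hm hX01 hX1 hX2 hnorm horth.
  have [Xf0 Xfn XtP] := B _ l32; exists (Num.min l2 lq); first exact: l3_itv.
  split; [|exact: Xf0| |].
  - by move=> l /l31 /primary.
  - move=> _; split; [exact: XtP|move=> l hl; exists (2 * pi / `|w l|), (Xf l)].
    split; first exact/primary/l31.
    by apply: Xfn; case/andP: hl => /ltW -> ->.
  - by move=> [n _ nE]; case: (nres n).
have [Xf0 XfE] := hXf2 res.
have [l2 /cut[l3_itv l32 l31] B] := resonant_branch hX0 hX0n wn w0 ZD Z0 hal0 hk
  l1_itv hg hm (ex_intro _ Cw hCw) res Xf0 XfE.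
exists (Num.min l2 lq); [exact: l3_itv|split; [|exact: Xf0| |]].
- by move=> l /l31 /primary.
- by have [n _ nE] := res; move=> /(_ n).
- by move=> _; exact: B.
Qed.
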